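(* Let $E$ be a locally compact separable metric space, let $\{T_t\}_{t\ge 0}$ be a strong Feller semigroup on $E$ with transition kernel $\{p_{t,x}\}_{t\ge 0,\,x\in E}$, and let $\diamond$ be a bilinear operator on $\mathcal{M}_{\mathbb{C}}(E)$ satisfying the following three conditions for some point $a\in E$: (I) $(\mathcal{M}_{\mathbb{C}}(E),\diamond)$ is a commutative Banach algebra over $\mathbb{C}$ (with respect to the total variation norm) with identity element $\delta_a$, and the map $(\mu,\nu)\mapsto \mu\diamond\nu$ is continuous in the weak topology of measures; (II) $\mathcal{P}(E)\diamond\mathcal{P}(E)\subset\mathcal{P}(E)$; (IV) there is a family $\{\gamma_t\}_{t\ge 0}\subset\mathcal{P}(E)$ with $\gamma_{t+s}=\gamma_t\diamond\gamma_s$ for all $t,s\ge 0$ such that $p_{t,x}=\gamma_t\diamond\delta_x$ for all $t\ge 0$, $x\in E$. Suppose that $\vartheta\in \mathrm{B}_{\mathrm{b}}(E)$, $\vartheta\not\equiv 0$, is a function such that $$(\delta_x\diamond\delta_y)(\vartheta)=\vartheta(x)\,\vartheta(y)\qquad\text{for all }x,y\in E.$$ Then $\vartheta(a)=\|\vartheta\|_\infty=1$. Moreover, $\vartheta$ is an eigenfunction of the $\mathrm{C}_{\mathrm{b}}$-generator $(\mathcal{G}^{(b)},\mathcal{D}(\mathcal{G}^{(b)}))$ of $\{T_t\}$ associated with an eigenvalue of nonpositive real part, in the sense that $\vartheta\in\mathcal{D}(\mathcal{G}^{(b)})$ and $\mathcal{G}^{(b)}\vartheta=-\lambda\vartheta$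 for some $\lambda\in\mathbb{C}$ with $\operatorname{Re}\lambda\ge 0$.
   Context: $\mathcal{M}_{\mathbb{C}}(E)$ and $\mathcal{P}(E)$ denote the finite complex Borel measures and the Borel probability measures on $E$; $\delta_x$ is the Dirac measure at $x$; the weak topology is the one induced by integration against bounded continuous functions. $\mathrm{B}_{\mathrm{b}}(E)$ is the space of bounded measurable complex-valued functions on $E$ with the norm $\|f\|_\infty=\sup_{x\in E}|f(x)|$; $\mathrm{C}_{\mathrm{b}}(E)$ is the space of bounded continuous functions; $\mathrm{C}_0(E)$ is the space of continuous functions vanishing at infinity. For a measure $\mu$ and a function $\vartheta$, $\mu(\vartheta):=\int_E\vartheta\,d\mu$. A Feller semigroup on $E$ is a strongly continuous semigroup $\{T_t\}_{t\ge0}$ of positive linear contractions on $\mathrm{C}_0(E)$. Its transition kernel $\{p_{t,x}\}$ is the family of (sub-)probability measures with $(T_tf)(x)=\int_E f\,dp_{t,x}$, and $T_t$ is extended to $\mathrm{B}_{\mathrm{b}}(E)$ by this formula. It is strong Feller if $T_t(\mathrm{B}_{\mathrm{b}}(E))\subset\mathrm{C}_{\mathrm{b}}(E)$ for all $t>0$. For $\eta>0$, the $\eta$-resolvent operator is $\mathcal{R}_\eta:\mathrm{C}_{\mathrm{b}}(E)\to\mathrm{C}_{\mathrm{b}}(E)$, $\mathcal{R}_\eta f=\int_0^\infty e^{-\eta t}T_tf\,dt$. The $\mathrm{C}_{\mathrm{b}}$-generator $(\mathcal{G}^{(b)},\mathcal{D}(\mathcal{G}^{(b)}))$ is the operator with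 domain $\mathcal{D}(\mathcal{G}^{(b)})=\mathcal{R}_\eta(\mathrm{C}_{\mathrm{b}}(E))$ given by $(\mathcal{G}^{(b)}u)(x)=\eta u(x)-g(x)$ for $u=\mathcal{R}_\eta g$, $g\in\mathrm{C}_{\mathrm{b}}(E)$, $x\in E$ (this is independent of $\eta$). *)

(* Defs.v *)
From HB Require Import structures.
From mathcomp Require Import all_boot all_order all_algebra.
From mathcomp Require Import all_classical all_reals all_analysis.
From mathcomp.real_closed Require Export complex.

Set Implicit Arguments.
Unset Strict Implicit.
Unset Printing Implicit Defensive.
Import Order.TTheory GRing.Theory Num.Theory.
Import numFieldNormedType.Exports.
Local Open Scope classical_set_scope.
Local Open Scope ring_scope.
Local Open Scope complex_scope.

HB.instance Definition _ (R : rcfType) := NormedModule.copy R[i] (R[i]^o).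

(* The library's sigma-algebras live on pointed types; this costs nothing here
   since the identity element [a] makes the space nonempty. *)
#[short(type="pointedMetricType")]
HB.structure Definition PointedMetric (R : numDomainType) :=
  {M of Pointed M & Metric R M}.

Notation borel E := (g_sigma_algebraType (@open E)).

Definition separable_space (E : topologicalType) : Prop :=
  exists2 D : set E, countable D & dense D.

Section ComplexMeasure.
Context d (X : measurableType d) (R : realType).
Implicit Types mu : set X -> R[i].

Definition complex_sigma_additive mu : Prop :=
  forall F : nat -> set X, (forall i, measurable (F i)) -> trivIset setT F ->
    (fun n => \sum_(0 <= i < n) mu (F i)) @ \oo --> mu (\bigcup_i F i).

(* Set functions are total on [set X]: the value 0 is imposed on nonmeasurable
   sets so that two complex measures are equal in the sense of [=] as soon as
   they agree on the measurable sets. *)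
Definition is_complex_measure mu : Prop :=
  [/\ mu set0 = 0, complex_sigma_additive mu &
      forall A, ~ measurable A -> mu A = 0].

Definition complex_measure_pred : {pred set X -> R[i]} :=
  [pred mu | `[< is_complex_measure mu >]].

Record complex_measure := ComplexMeasure {
  complex_measure_fun :> set X -> R[i] ;
  _ : complex_measure_fun \in complex_measure_pred }.

HB.instance Definition _ := [isSub for complex_measure_fun].
HB.instance Definition _ := [Choice of complex_measure by <:].

Lemma complex_measureP (m : complex_measure) : is_complex_measure m.
Proof. by case: m => m /= /[!inE]. Qed.

Lemma complex_measure_submod : submod_closed complex_measure_pred.
Proof.
split=> [|c mu nu].
  rewrite inE; split=> // F _ _.
  rewrite (_ : (fun n => _) = fun=> 0); last first.
    by apply/funext => n; rewrite big1.
  exact: cvg_cst.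
rewrite !inE => -[mu0 muS muN] [nu0 nuS nuN].
split=> [|F mF tF|A mA].
- by rewrite !fctE mu0 nu0 scaler0 addr0.
- rewrite (_ : (fun n => _) =
    (c \*: (fun n => \sum_(0 <= i < n) mu (F i))) +
     (fun n => \sum_(0 <= i < n) nu (F i))); last first.
    apply/funext => n; rewrite !fctE big_split/=; congr (_ + _).
    by rewrite scaler_sumr.
  by apply: cvgD; [apply: cvgZl_tmp; exact: muS|exact: nuS].
- by rewrite !fctE muN// nuN// scaler0 addr0.
Qed.

HB.instance Definition _ := GRing.isSubmodClosed.Build R[i] (set X -> R[i])
  complex_measure_pred complex_measure_submod.
HB.instance Definition _ := [SubChoice_isSubLmodule of complex_measure by <:].

Section OfFiniteMeasure.
Variable m : {finite_measure set X -> \bar R}.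

Definition of_finite_measure_fun (A : set X) : R[i] :=
  if `[< measurable A >] then (fine (m A))%:C else 0.

Lemma real_complex_cvg (u : nat -> R) (l : R) :
  u @ \oo --> l -> (fun n => (u n)%:C) @ \oo --> l%:C.
Proof.
move=> /cvgrPdist_lt ul; apply/cvgrPdist_lt => -[e e'].
rewrite ltcE/= => /andP[/eqP -> e0].
have := ul _ e0; apply: filterS => n.
by rewrite -rmorphB/= normc_def/= expr0n/= addr0 sqrtr_sqr ltcR.
Qed.

Lemma of_finite_measure_subproof :
  of_finite_measure_fun \in complex_measure_pred.
Proof.
rewrite inE; split.
- rewrite /of_finite_measure_fun asboolT; last exact: measurable0.
  by rewrite measure0.
- move=> F mF tF; rewrite /of_finite_measure_fun asboolT; last first.
    exact: bigcupT_measurable.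
  rewrite (_ : (fun n => _) =
      (fun n => (fine (\sum_(0 <= i < n) m (F i))%E)%:C)); last first.
    apply/funext => n; rewrite -sum_fine; last first.
      by move=> i _; exact: fin_num_measure.
    rewrite rmorph_sum; apply: eq_bigr => i _.
    by rewrite asboolT.
  apply: real_complex_cvg; apply: fine_cvg; rewrite fineK; last first.
    by apply: fin_num_measure; exact: bigcupT_measurable.
  by apply: measure_semi_sigma_additive => //; exact: bigcupT_measurable.
- by move=> A mA; rewrite /of_finite_measure_fun asboolF.
Qed.

Definition of_finite_measure : complex_measure :=
  ComplexMeasure of_finite_measure_subproof.

End OfFiniteMeasure.

Lemma cvg_Re (u : nat -> R[i]) (l : R[i]) :
  u @ \oo --> l -> (fun n => complex.Re (u n)) @ \oo --> complex.Re l.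
Proof.
move=> /cvgrPdist_lt ul; apply/cvgrPdist_lt => e e0.
have /ul : 0 < e%:C by rewrite ltcR.
apply: filterS => n; rewrite -raddfB -ltcR; apply: le_lt_trans.
exact: normc_ge_Re.
Qed.

Lemma cvg_Im (u : nat -> R[i]) (l : R[i]) :
  u @ \oo --> l -> (fun n => complex.Im (u n)) @ \oo --> complex.Im l.
Proof.
move=> /cvgrPdist_lt ul; apply/cvgrPdist_lt => e e0.
have /ul : 0 < e%:C by rewrite ltcR.
apply: filterS => n; rewrite -raddfB -ltcR; apply: le_lt_trans.
by rewrite normc_def lecR -sqrtr_sqr ler_wsqrtr// lerDr sqr_ge0.
Qed.

Definition Re_measure (m : complex_measure) (A : set X) : \bar R :=
  (complex.Re (m A))%:E.
Definition Im_measure (m : complex_measure) (A : set X) : \bar R :=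
  (complex.Im (m A))%:E.

Section ReIm.
Variable m : complex_measure.

Let Re0 : Re_measure m set0 = 0%E.
Proof. by have [m0 _ _] := complex_measureP m; rewrite /Re_measure m0. Qed.

Let Re_fin A : measurable A -> Re_measure m A \is a fin_num.
Proof. by []. Qed.

Let Re_sigma : measure_function.semi_sigma_additive (Re_measure m).
Proof.
move=> F mF tF _; have [_ mS _] := complex_measureP m.
rewrite (_ : (fun n => _) = (fun n => (complex.Re (\sum_(0 <= i < n) m (F i)))%:E)).
  by apply: cvg_EFin; [exact: nearW|apply: cvg_Re; exact: mS].
by apply/funext => n; rewrite raddf_sum sumEFin.
Qed.

HB.instance Definition _ :=
  isCharge.Build _ X R (Re_measure m) Re0 Re_fin Re_sigma.

Let Im0 : Im_measure m set0 = 0%E.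
Proof. by have [m0 _ _] := complex_measureP m; rewrite /Im_measure m0. Qed.

Let Im_fin A : measurable A -> Im_measure m A \is a fin_num.
Proof. by []. Qed.

Let Im_sigma : measure_function.semi_sigma_additive (Im_measure m).
Proof.
move=> F mF tF _; have [_ mS _] := complex_measureP m.
rewrite (_ : (fun n => _) = (fun n => (complex.Im (\sum_(0 <= i < n) m (F i)))%:E)).
  by apply: cvg_EFin; [exact: nearW|apply: cvg_Im; exact: mS].
by apply/funext => n; rewrite raddf_sum sumEFin.
Qed.

HB.instance Definition _ :=
  isCharge.Build _ X R (Im_measure m) Im0 Im_fin Im_sigma.

End ReIm.

Definition total_variation (m : complex_measure) : \bar R :=
  ereal_sup [set (\sum_(i <oo) (Normc.normc (m (F i)))%:E)%E | F in
    [set F : nat -> set X | [/\ forall i, measurable (F i), trivIset setT F &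
                                \bigcup_i F i = setT]]].

Definition complex_integral (m : {measure set X -> \bar R}) (D : set X)
    (f : X -> R[i]) : R[i] :=
  (\int[m]_(x in D) complex.Re (f x)) +i* (\int[m]_(x in D) complex.Im (f x)).

(* The positive and negative parts do not depend on the chosen Hahn
   decomposition, by [Hahn_decomposition_uniq]. *)
Definition charge_integral (nu : {charge set X -> \bar R}) (f : X -> R[i]) :
    R[i] :=
  let: exist P PN := cid (Hahn_decomposition nu) in
  let: exist N nuPN := cid PN in
  complex_integral (jordan_pos nuPN) setT f -
  complex_integral (jordan_neg nuPN) setT f.

Definition integral_complex_measure (m : complex_measure) (f : X -> R[i]) :
    R[i] :=
  charge_integral (Re_measure m) f + 'i * charge_integral (Im_measure m) f.

End ComplexMeasure.

Section FunctionSpaces.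
Context (R : realType) (E : pointedMetricType R).
Implicit Types f : E -> R[i].

Definition sup_norm f : R := sup (range (fun x => Normc.normc (f x))).

Definition bounded_function f : Prop :=
  exists M : R, forall x, Normc.normc (f x) <= M.

Definition Bb f : Prop :=
  measurable_fun setT (f : borel E -> borel R[i]) /\ bounded_function f.

Definition Cb f : Prop := continuous f /\ bounded_function f.

Definition C0 f : Prop :=
  continuous f /\
  forall e : R, 0 < e -> exists2 K : set E, compact K &
    forall x, ~ K x -> Normc.normc (f x) < e.

End FunctionSpaces.

Section FellerSemigroup.
Context (R : realType) (E : pointedMetricType R).
Implicit Types (T : R -> (E -> R[i]) -> E -> R[i])
  (p : R -> E -> subprobability (borel E) R) (f g u v : E -> R[i]).

(* [T t f] is only meaningful for [0 <= t] and [C0 f]. The order of [R[i]] is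
   such that [0 <= z] means that [z] is real and nonnegative. *)
Record feller_semigroup T : Prop := FellerSemigroup {
  feller_C0 : forall t f, 0 <= t -> C0 f -> C0 (T t f) ;
  feller_linear : forall t c f g, 0 <= t -> C0 f -> C0 g ->
    T t (c *: f + g) = c *: T t f + T t g ;
  feller_positive : forall t f, 0 <= t -> C0 f ->
    (forall x, 0 <= f x) -> forall x, 0 <= T t f x ;
  feller_contraction : forall t f, 0 <= t -> C0 f ->
    sup_norm (T t f) <= sup_norm f ;
  feller_id : forall f, C0 f -> T 0 f = f ;
  feller_comp : forall s t f, 0 <= s -> 0 <= t -> C0 f ->
    T (s + t) f = T s (T t f) ;
  feller_cvg : forall f, C0 f ->
    sup_norm (T t f - f) @[t --> 0^'+] --> (0 : R) }.

Definition kernel_op p (t : R) f (x : E) : R[i] :=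
  complex_integral (p t x) setT f.

Definition transition_kernel T p : Prop :=
  forall t f x, 0 <= t -> C0 f -> T t f x = kernel_op p t f x.

Definition strong_feller p : Prop :=
  forall t f, 0 < t -> Bb f -> Cb (kernel_op p t f).

Definition resolvent p (eta : R) f (x : E) : R[i] :=
  complex_integral lebesgue_measure `[0, +oo[
    (fun t => (expR (- (eta * t)))%:C * kernel_op p t f x).

(* Graph of the generator: [u] is in its domain and is mapped to [v]. Neither the
   domain nor the value depends on [eta > 0]. *)
Definition Cb_generator p (eta : R) u v : Prop :=
  exists g, [/\ Cb g, u = resolvent p eta g &
                forall x, v x = eta%:C * u x - g x].

End FellerSemigroup.

Section Convolution.
Context (R : realType) (E : pointedMetricType R).
Local Notation M := (complex_measure (borel E) R).
Implicit Types (op : M -> M -> M).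

Definition delta (x : E) : M := of_finite_measure (\d_(x : borel E)).

Definition pairing (mu : M) : {ptws {f : E -> R[i] | Cb f} -> R[i]} :=
  fun f => integral_complex_measure mu (sval f).

(* The type [M] with the coarsest topology that makes [mu |-> mu(f)] continuous
   for each bounded continuous [f]. *)
Definition weak_measure := initial_topology pairing.

Definition bilinear_op op : Prop :=
  (forall nu, linear (op^~ nu)) /\ (forall mu, linear (op mu)).

(* The total variation norm is always complete: no hypothesis is needed. *)
Definition commutative_banach_algebra op (e : M) : Prop :=
  [/\ bilinear_op op, associative op, commutative op, left_id e op &
      forall mu nu,
        (total_variation (op mu nu) <=
         total_variation mu * total_variation nu)%E].

Definition weakly_continuous_op op : Prop :=
  continuous (fun munu : weak_measure * weak_measure =>
                op munu.1 munu.2 : weak_measure).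

Definition preserves_probability op : Prop :=
  forall mu nu : probability (borel E) R, exists rho : probability (borel E) R,
    op (of_finite_measure mu) (of_finite_measure nu) = of_finite_measure rho.

Definition generated_by_convolution_semigroup op
    (p : R -> E -> subprobability (borel E) R) : Prop :=
  exists gamma : R -> probability (borel E) R,
    (forall s t, 0 <= s -> 0 <= t ->
      of_finite_measure (gamma (t + s)) =
      op (of_finite_measure (gamma t)) (of_finite_measure (gamma s))) /\
    (forall t x, 0 <= t ->
      of_finite_measure (p t x) = op (of_finite_measure (gamma t)) (delta x)).

End Convolution.

(* Main.v *)
Require Import Defs.
From mathcomp Require Import all_boot all_order all_algebra.
From mathcomp Require Import all_classical all_reals all_analysis.
From mathcomp Require Import measurable_realfun zify ring lra.
Import Order.TTheory GRing.Theory Num.Theory.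
Import numFieldNormedType.Exports.
Local Open Scope classical_set_scope.
Local Open Scope ring_scope.
Local Open Scope complex_scope.

(** Write [mu(f)] for the integral of [f], [mu nu] for the convolution product and
    [T_t f (x) = (gamma_t delta_x)(f)] for the semigroup. Since [delta_a] is the
    unit, [theta(a) = 1]; since products of probabilities are probabilities,
    [|theta(x) theta(y)|] is at most the norm of [theta], which is therefore 1.
    The disintegration [(mu nu)(f) = \int (delta_x nu)(f) mu(dx)] ([translate_Cb],
    [translate_bmeas]) turns the multiplicativity of [theta] on unit masses into
    [T_t theta = c(t) theta] with [c(t) = gamma_t(theta)], where
    [c(s + t) = c(s) c(t)] and [|c| <= 1].

    If [c(t) <> 0] for a single [t > 0] then [theta = T_t theta / c(t)] is
    continuous by the strong Feller property. As [gamma_t] converges weakly to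
    [delta_a] ([gamma_cvg]), [c] then tends to 1 at 0, its Laplace transform is
    [1 / (eta + lambda)] ([laplace_multiplicative]), and [theta] is the
    [eta]-resolvent of [(eta + lambda) theta], which is the claim.

    The difficulty is to exclude [c = 0] while [theta] is only known to be
    measurable, and hence blind to weak convergence. Here joint weak continuity of
    the product on all complex measures is decisive. A bilinear form that is
    jointly continuous for weak topologies has finite rank ([op_finite_rank]), so,
    for [f] in [Cb] and modulo the ideal of the [nu] such that [(mu nu)(f) = 0]
    for all [mu], convolution takes place in a finite-dimensional algebra. There
    [gamma_t] tends to the unit as [t] tends to 0; it is invertible for small [t],
    and then for all [t] because it is a power of [gamma_(t/k)]
    ([gamma_weakly_invertible]). It follows that every [T_t] is a bijection of
    [Cb], and by the strong Feller property that each bounded Borel [h] has the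
    same images under [T_t], for [0 < t < 1], as some [g] in [Cb]. Consequently
    [gamma_t(h)] has a limit as [t] tends to 0 for every bounded Borel [h]
    ([gamma_Bb_cvg]). A gliding hump argument ([concentration_charges_zero_set])
    shows that this is compatible with weak convergence to [delta_a] only if
    [gamma_t({a}) > 1/2] for some [t > 0], and then
    [|c(t)| >= 2 gamma_t({a}) - 1 > 0].

    On the half-line with the ordinary convolution, jointly continuous on
    probabilities but not on all complex measures, the gamma process and the
    indicator of [{0}] show that [c = 0] does occur without finite rank. *)

Set Implicit Arguments.
Unset Strict Implicit.
Unset Printing Implicit Defensive.

Local Notation Re := complex.Re.
Local Notation Im := complex.Im.
Local Notation normc := Normc.normc.

(** * Complex numbers and bounded measurable functions *)

Section ComplexFacts.
Context (R : realType).
Implicit Types z w : R[i].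

Lemma normc_norm z : (normc z)%:C = `|z|.
Proof. by rewrite normc_def; case: z. Qed.

Lemma normc_ge0 z : 0 <= normc z.
Proof. by rewrite -ler0c normc_norm. Qed.

Lemma ler_normcD z w : normc (z + w) <= normc z + normc w.
Proof. by rewrite -lecR rmorphD/= !normc_norm ler_normD. Qed.

Lemma normc_opp z : normc (- z) = normc z.
Proof. by apply: complexI; rewrite !normc_norm normrN. Qed.

Lemma normc_eq0 z : (normc z == 0) = (z == 0).
Proof. by apply/eqP/eqP => [/Normc.eq0_normc|->] //; rewrite Normc.normc0. Qed.

Lemma Re_mul z w : Re (z * w) = Re z * Re w - Im z * Im w.
Proof. by case: z; case: w. Qed.

Lemma Im_mul z w : Im (z * w) = Re z * Im w + Im z * Re w.
Proof. by case: z => a b; case: w => c d /=. Qed.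

Lemma Re_add z w : Re (z + w) = Re z + Re w.
Proof. by case: z; case: w. Qed.

Lemma Im_add z w : Im (z + w) = Im z + Im w.
Proof. by case: z; case: w. Qed.

Lemma Re_opp z : Re (- z) = - Re z. Proof. by case: z. Qed.
Lemma Im_opp z : Im (- z) = - Im z. Proof. by case: z. Qed.

Lemma Re_le_normc z : `|Re z| <= normc z.
Proof. by case: z => a b; rewrite /= -sqrtr_sqr ler_wsqrtr// lerDl sqr_ge0. Qed.

Lemma Im_le_normc z : `|Im z| <= normc z.
Proof. by case: z => a b; rewrite /= -sqrtr_sqr ler_wsqrtr// lerDr sqr_ge0. Qed.

Lemma normc_real (x : R) : normc x%:C = `|x|.
Proof. by rewrite /= expr0n addr0 sqrtr_sqr. Qed.

Lemma normc_le_ReIm z : normc z <= `|Re z| + `|Im z|.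
Proof.
rewrite -lecR normc_norm [X in `|X|]complexE (le_trans (ler_normD _ _))//.
by rewrite rmorphD/= normrM -!normc_norm !normc_real/= expr0n expr1n add0r sqrtr1 mul1r.
Qed.

Lemma cvg_complexP {T : Type} {F : set_system T} {FF : Filter F}
    (f : T -> R[i]) (l : R[i]) :
  (f @ F --> l) <->
  ((fun x => Re (f x)) @ F --> Re l) /\ ((fun x => Im (f x)) @ F --> Im l).
Proof.
split=> [fl|[/cvgrPdist_lt fl /cvgrPdist_lt gl]].
  by split; apply/cvgrPdist_lt => e e0;
    have /cvgrPdist_lt/(_ e%:C) := fl; rewrite ltcR => /(_ e0);
    apply: filterS => x; rewrite -normc_norm ltcR; apply: le_lt_trans;
    rewrite -?Re_opp -?Re_add -?Im_opp -?Im_add ?Re_le_normc ?Im_le_normc.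
apply/cvgrPdist_lt => -[e e'].
rewrite ltcE/= => /andP[/eqP -> e0].
have e2 : 0 < e / 2 by rewrite divr_gt0.
near=> x.
rewrite -normc_norm ltcR (le_lt_trans (normc_le_ReIm _))// [e]splitr ltrD//.
  by rewrite Re_add Re_opp; near: x; exact: fl.
by rewrite Im_add Im_opp; near: x; exact: gl.
Unshelve. all: by end_near. Qed.

Lemma cvg_normcP {T : Type} {F : set_system T} {FF : Filter F}
    (f : T -> R[i]) (l : R[i]) :
  (f @ F --> l) <-> forall e : R, 0 < e -> \forall x \near F, normc (f x - l) < e.
Proof.
split=> [/cvgrPdist_lt fl e e0|fl].
  have := fl e%:C; rewrite ltcR => /(_ e0).
  by apply: filterS => x; rewrite -normrN opprB -normc_norm ltcR.
apply/cvgrPdist_lt => -[e e']; rewrite ltcE/= => /andP[/eqP -> e0].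
by apply: filterS (fl e e0) => x; rewrite -normrN opprB -normc_norm ltcR.
Qed.

End ComplexFacts.

Definition cindic {X : Type} {R : realType} (A : set X) (x : X) : R[i] := (\1_A x)%:C.

Section BoundedMeasurable.
Context d (X : measurableType d) (R : realType).
Implicit Types (f g : X -> R[i]) (A : set X).

(** Stated on real and imaginary parts because the complex integral is computed
    from them. *)
Definition bmeas f : Prop :=
  [/\ measurable_fun setT (fun x => Re (f x)),
      measurable_fun setT (fun x => Im (f x)) &
      exists M : R, forall x, normc (f x) <= M].

Definition bounded_cvg (f_ : nat -> X -> R[i]) f : Prop :=
  (exists M : R, forall n x, normc (f_ n x) <= M) /\
  forall x, f_ n x @[n --> \oo] --> f x.

Lemma bmeas_indic A : measurable A -> bmeas (cindic A).
Proof.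
move=> mA; split.
- exact: measurable_indic.
- exact: measurable_cst.
- by exists 1 => x; rewrite normc_real indicE; case: (_ \in _); rewrite ?normr1 ?normr0.
Qed.

Lemma bmeas_cst (c : R[i]) : bmeas (cst c).
Proof. by split; [exact: measurable_cst|exact: measurable_cst|exists (normc c)]. Qed.

Lemma bmeas_lin (c : R[i]) f g : bmeas f -> bmeas g ->
  bmeas (fun x => c * f x + g x).
Proof.
move=> [mf1 mf2 [M fM]] [mg1 mg2 [N gN]]; split.
- apply: (eq_measurable_fun (fun x => Re c * Re (f x) - Im c * Im (f x) + Re (g x))).
    by move=> x _; rewrite Re_add Re_mul.
  by apply: measurable_funD => //; apply: measurable_funB; exact: measurable_funM.
- apply: (eq_measurable_fun (fun x => Re c * Im (f x) + Im c * Re (f x) + Im (g x))).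
    by move=> x _; rewrite Im_add Im_mul.
  by apply: measurable_funD => //; apply: measurable_funD; exact: measurable_funM.
- exists (normc c * M + N) => x; apply: le_trans (ler_normcD _ _) _.
  by rewrite lerD// Normc.normcM ler_wpM2l ?normc_ge0.
Qed.

Lemma bmeasZ (c : R[i]) f : bmeas f -> bmeas (fun x => c * f x).
Proof.
move=> bf; have := bmeas_lin c bf (bmeas_cst 0).
by congr bmeas; apply/funext => x; rewrite addr0.
Qed.

Lemma bmeasB f g : bmeas f -> bmeas g -> bmeas (fun x => f x - g x).
Proof.
move=> bf bg; have := bmeas_lin (-1) bg bf.
by congr bmeas; apply/funext => x; rewrite mulN1r addrC.
Qed.

Lemma bmeas_cvg (f_ : nat -> X -> R[i]) f :
  (forall n, bmeas (f_ n)) -> bounded_cvg f_ f -> bmeas f.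
Proof.
move=> bf [[M fM] ff]; split.
- apply: (@measurable_fun_cvg _ _ _ _ (fun n x => Re (f_ n x))).
    by move=> n; have [] := bf n.
  by move=> x _; have /cvg_complexP[] := ff x.
- apply: (@measurable_fun_cvg _ _ _ _ (fun n x => Im (f_ n x))).
    by move=> n; have [] := bf n.
  by move=> x _; have /cvg_complexP[] := ff x.
- exists M => x; rewrite leNgt; apply/negP => Mx.
  have e0 : 0 < normc (f x) - M by rewrite subr_gt0.
  have [n _ /(_ n (leqnn n))] := (@cvg_normcP _ _ _ _ _ _).1 (ff x) _ e0.
  rewrite ltNge => /negP; apply.
  rewrite lerBlDr; have := ler_normcD (f x - f_ n x) (f_ n x).
  rewrite subrK => /le_trans; apply.
  by rewrite -normc_opp opprB lerD.
Qed.

Section Induction.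
Variable H : (X -> R[i]) -> Prop.
Hypothesis H1 : forall A, measurable A -> H (cindic A).
Hypothesis Hlin : forall (c : R[i]) f g, bmeas f -> bmeas g -> H f -> H g ->
  H (fun x => c * f x + g x).
Hypothesis Hcvg : forall (f_ : nat -> X -> R[i]) f,
  (forall n, bmeas (f_ n)) -> (forall n, H (f_ n)) ->
  bounded_cvg f_ f -> H f.

Let H_cst (c : R[i]) : H (cst c).
Proof.
have H0 : H (cst 0).
  by have := H1 measurable0; congr H; apply/funext => x; rewrite /cindic indic0.
have := Hlin c (bmeas_indic (@measurableT _ X)) (bmeas_cst 0) (H1 measurableT) H0.
congr H; apply/funext => x.
by rewrite /cindic indicT/= addr0 mulr1.
Qed.

Let H_sum (I : Type) (s : seq I) (c : R[i]) (A : I -> set X) :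
  (forall i, measurable (A i)) ->
  H (fun x => \sum_(i <- s) c * cindic (A i) x) /\
  bmeas (fun x => \sum_(i <- s) c * cindic (A i) x).
Proof.
move=> mA; elim: s => [|i s [IH1 IH2]].
  by split; [have := H_cst 0|have := bmeas_cst 0];
    [congr H|congr bmeas]; apply/funext => x; rewrite big_nil.
split; under eq_fun do rewrite big_cons.
  by apply: Hlin => //; [exact: bmeas_indic|exact: H1].
by apply: bmeas_lin => //; exact: bmeas_indic.
Qed.

Lemma sum_ltn_real (N t : nat) : (t <= N)%N ->
  \sum_(k < N) ((k < t)%N%:R : R) = t%:R.
Proof.
move=> tN; rewrite -natr_sum; congr (_%:R).
rewrite -[RHS]card_ord -sum1_card (big_ord_widen _ (fun=> 1%N) tN).
by rewrite [RHS]big_mkcond; apply: eq_bigr => i _; case: ltnP.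
Qed.

(** Layer-cake approximation: with [n] for [n.+1], the function
    [n^-1 * \sum_(k < N) (k + 1 <= n * g)] is [n^-1] times the integer part of
    [n * g], hence is within [n^-1] of [g]. *)
Let H_real (g : X -> R) (M : R) : measurable_fun setT g ->
  (forall x, 0 <= g x <= M) -> H (fun x => (g x)%:C).
Proof.
move=> mg gM.
pose N n := ((Num.truncn M).+1 * n.+1)%N.
pose A n (k : nat) := [set x | k.+1%:R <= g x * n.+1%:R].
have mA n k : measurable (A n k).
  rewrite -[A n k]setTI; apply: measurable_fun_ler => //.
  by apply: measurable_funM => //.
pose f_ n x : R[i] := \sum_(k <- index_enum 'I_(N n)) n.+1%:R^-1%:C * cindic (A n k) x.
have f_E n x : f_ n x = (n.+1%:R^-1 * (Num.truncn (g x * n.+1%:R))%:R)%:C.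
  have g0 : 0 <= g x * n.+1%:R by rewrite mulr_ge0//; case/andP: (gM x).
  rewrite /f_ -mulr_sumr rmorphM/=; congr (_ * _).
  rewrite /cindic -(rmorph_sum (real_complex R))/=; congr (_ %:C).
  rewrite -(@sum_ltn_real (N n) (Num.truncn (g x * n.+1%:R))); last first.
    rewrite -(ler_nat R); apply: (@le_trans _ _ (g x * n.+1%:R)).
      by have /andP[] := truncn_itv g0.
    rewrite natrM ler_wpM2r//.
    have /andP[_ /le_trans] := gM x; apply.
    have M0 : 0 <= M by case/andP: (gM x) => ? /(le_trans _); apply.
    by have /andP[_ /ltW] := truncn_itv M0.
  apply: eq_bigr => k _; rewrite indicE /A; congr (_%:R).
  by rewrite truncn_ge_nat//; congr nat_of_bool; apply/idP/idP => [/set_mem|/mem_set].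
have near0 n x : `|g x - n.+1%:R^-1 * (Num.truncn (g x * n.+1%:R))%:R| <= n.+1%:R^-1.
  have g0 : 0 <= g x * n.+1%:R by rewrite mulr_ge0//; case/andP: (gM x).
  have /andP[t1 t2] := truncn_itv g0.
  have gE : g x = n.+1%:R^-1 * (g x * n.+1%:R) by rewrite mulrCA mulVf ?mulr1 ?pnatr_eq0.
  rewrite [X in `|X - _|]gE -mulrBr normrM.
  rewrite ger0_norm ?invr_ge0// ler_piMr ?invr_ge0//.
  rewrite ger0_norm ?subr_ge0// lerBlDr.
  by apply: ltW; rewrite (lt_le_trans t2)// -natr1 addrC.
apply: (@Hcvg f_).
- by move=> n; have [] := H_sum (index_enum 'I_(N n)) n.+1%:R^-1%:C (fun k => mA n (nat_of_ord k)).
- by move=> n; have [] := H_sum (index_enum 'I_(N n)) n.+1%:R^-1%:C (fun k => mA n (nat_of_ord k)).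
split.
  exists (M + 1) => n x; rewrite f_E normc_real.
  have /andP[g0 g1] := gM x.
  rewrite -[X in `|X|](subKr (g x)) (le_trans (ler_normB _ _))// lerD ?(ger0_norm g0)//.
  by rewrite (le_trans (near0 n x))// invf_le1// ler1n.
move=> x; under eq_fun do rewrite f_E.
apply: real_complex_cvg.
apply/cvgrPdist_le => e e0; near=> n.
apply: le_trans (near0 n x) _.
by apply: ltW; near: n; exact: (near_infty_natSinv_lt (PosNum e0)).
Unshelve. all: by end_near. Qed.

(** Functional monotone class principle: bounded measurable functions are
    uniform limits of finite combinations of indicators. *)
Lemma bmeas_ind f : bmeas f -> H f.
Proof.
move=> [m1 m2 [M fM]].
have part (u : X -> R) : measurable_fun setT u -> (forall x, `|u x| <= M) ->
    H (fun x => (u x)%:C) /\ bmeas (fun x => (u x)%:C).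
  move=> mu uM.
  have bu (v : X -> R) N : measurable_fun setT v -> (forall x, `|v x| <= N) ->
      bmeas (fun x => (v x)%:C).
    move=> mv vN; split => //=.
    by exists N => x; rewrite expr0n addr0 sqrtr_sqr.
  split; last exact: bu uM.
  have mv : measurable_fun setT (fun x => u x + M) by exact: measurable_funD.
  have uM' x : 0 <= u x + M <= M + M.
    by have := uM x; rewrite ler_norml lerD2r => /andP[? ->]; rewrite andbT -lerBlDr sub0r.
  have := Hlin 1 (bu _ (M + M) mv _) (bmeas_cst (- M%:C)) (H_real mv uM') (H_cst _).
  have -> : (fun x => 1 * (u x + M)%:C + cst (- M%:C) x) = (fun x => (u x)%:C).
    by apply/funext => x; rewrite mul1r/= rmorphD/= addrK.
  by apply => x; have /andP[? ?] := uM' x; rewrite ger0_norm.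
have [hr br] := part _ m1 (fun x => le_trans (Re_le_normc _) (fM x)).
have [hi bi] := part _ m2 (fun x => le_trans (Im_le_normc _) (fM x)).
have := Hlin 'i bi br hi hr; congr H; apply/funext => x.
by rewrite addrC -complexE.
Qed.

End Induction.

(** What integrals against positive, signed and complex finite measures have in
    common: linearity and the bounded convergence theorem. *)
Definition daniell (J : (X -> R[i]) -> R[i]) : Prop :=
  (forall (c : R[i]) f g, bmeas f -> bmeas g ->
     J (fun x => c * f x + g x) = c * J f + J g) /\
  (forall (f_ : nat -> X -> R[i]) f, (forall n, bmeas (f_ n)) -> bounded_cvg f_ f ->
     J (f_ n) @[n --> \oo] --> J f).

Lemma daniell_lin (c : R[i]) J1 J2 : daniell J1 -> daniell J2 ->
  daniell (fun f => c * J1 f + J2 f).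
Proof.
move=> [l1 c1] [l2 c2]; split.
  by move=> k f g bf bg; rewrite l1// l2//; ring.
move=> f_ f bf ff; apply: cvgD; last exact: c2.
by apply: cvgM; [exact: cvg_cst|exact: c1].
Qed.

Lemma daniellB J1 J2 : daniell J1 -> daniell J2 ->
  daniell (fun f => J1 f - J2 f).
Proof.
move=> d1 d2; have := daniell_lin (-1) d2 d1.
by congr daniell; apply/funext => f; rewrite mulN1r addrC.
Qed.

(** A functional of this kind is a measure in disguise; this is how every
    identity between integrals below is reduced to measurable sets. *)
Lemma daniell_eq J1 J2 : daniell J1 -> daniell J2 ->
  (forall A, measurable A -> J1 (cindic A) = J2 (cindic A)) ->
  forall f, bmeas f -> J1 f = J2 f.
Proof.
move=> [l1 c1] [l2 c2] J12; apply: bmeas_ind => //.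
  by move=> c f g bf bg fE gE; rewrite l1// l2// fE gE.
move=> f_ f bf fE ff; apply: (@cvg_unique _ (@norm_hausdorff _ R[i]) _ _ _ _ (c1 _ _ bf ff)).
have -> : (fun n => J1 (f_ n)) = (fun n => J2 (f_ n)) by apply/funext.
exact: c2.
Qed.

Section FiniteMeasure.
Variable m : {finite_measure set X -> \bar R}.

Lemma bounded_integrable (u : X -> R) (M : R) : measurable_fun setT u ->
  (forall x, `|u x| <= M) -> m.-integrable setT (EFin \o u).
Proof.
move=> mu uM; apply: measurable_bounded_integrable => //.
  by rewrite ltey_eq fin_num_measure.
exists M; split; first exact: num_real.
by move=> N MN x _; apply: le_trans (uM x) (ltW MN).
Qed.

Lemma Rintegral_dct (u_ : nat -> X -> R) (u : X -> R) (M : R) :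
  (forall n, measurable_fun setT (u_ n)) -> measurable_fun setT u ->
  (forall n x, `|u_ n x| <= M) -> (forall x, u_ n x @[n --> \oo] --> u x) ->
  \int[m]_(x in setT) u_ n x @[n --> \oo] --> \int[m]_(x in setT) u x.
Proof.
move=> mu_ mu uM uu.
have [] := @dominated_convergence _ _ _ m setT measurableT
  (fun n x => (u_ n x)%:E) (fun x => (u x)%:E) (fun=> M%:E).
- by move=> n; exact/measurable_EFinP.
- exact/measurable_EFinP.
- by apply: aeW => x _; apply: cvg_EFin; [exact: nearW|exact: uu].
- apply: (@bounded_integrable (fun=> M) `|M|); first exact: measurable_cst.
  by [].
- by apply: aeW => x n _; rewrite lee_fin.
move=> iu _ ; rewrite -[X in _ --> X -> _]fineK; first exact: fine_cvg.
exact: integrable_fin_num iu.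
Qed.

Lemma daniell_complex_integral : daniell (complex_integral m setT).
Proof.
split.
  move=> c f g [f1 f2 [M fM]] [g1 g2 [N gN]].
  have i1 := bounded_integrable f1 (fun x => le_trans (Re_le_normc _) (fM x)).
  have i2 := bounded_integrable f2 (fun x => le_trans (Im_le_normc _) (fM x)).
  have j1 := bounded_integrable g1 (fun x => le_trans (Re_le_normc _) (gN x)).
  have j2 := bounded_integrable g2 (fun x => le_trans (Im_le_normc _) (gN x)).
  have iZ (k : R) (u : X -> R) : m.-integrable setT (EFin \o u) ->
      m.-integrable setT (EFin \o (fun x => k * u x)).
    move=> iu; apply: (eq_integrable _ _ (fun x => k%:E * (u x)%:E)%E) => //.
    exact: integrableZl.
  have iB (v u : X -> R) : m.-integrable setT (EFin \o u) -> m.-integrable setT (EFin \o v) ->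
      m.-integrable setT (EFin \o (fun x => v x - u x)).
    move=> iu iv; apply: (eq_integrable _ _ (fun x => (v x)%:E - (u x)%:E)%E) => //.
    exact: integrableB.
  have iD (v u : X -> R) : m.-integrable setT (EFin \o u) -> m.-integrable setT (EFin \o v) ->
      m.-integrable setT (EFin \o (fun x => v x + u x)).
    move=> iu iv; apply: (eq_integrable _ _ (fun x => (v x)%:E + (u x)%:E)%E) => //.
    exact: integrableD.
  rewrite /complex_integral.
  under eq_Rintegral do rewrite Re_add Re_mul.
  under [X in _ +i* X]eq_Rintegral do rewrite Im_add Im_mul.
  rewrite RintegralD//; last by apply: iB; exact: iZ.
  rewrite RintegralB//; [|exact: iZ|exact: iZ].
  rewrite RintegralD//; last by apply: iD; exact: iZ.
  rewrite RintegralD//; [|exact: iZ|exact: iZ].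
  by rewrite !RintegralZl//; case: c.
move=> f_ f bf ff; have bf' := bmeas_cvg bf ff; have [[M fM] fc] := ff.
apply/cvg_complexP; split => /=.
  apply: (@Rintegral_dct _ _ M).
  - by move=> n; have [] := bf n.
  - by have [] := bf'.
  - by move=> n x; apply: le_trans (Re_le_normc _) (fM n x).
  - by move=> x; have /cvg_complexP[] := fc x.
apply: (@Rintegral_dct _ _ M).
- by move=> n; have [] := bf n.
- by have [] := bf'.
- by move=> n x; apply: le_trans (Im_le_normc _) (fM n x).
- by move=> x; have /cvg_complexP[] := fc x.
Qed.

Lemma complex_integral_indic A : measurable A ->
  complex_integral m setT (cindic A) = (fine (m A))%:C.
Proof.
move=> mA; rewrite /complex_integral /cindic /=.
rewrite Rintegral_cst// mul0r; congr (_ +i* _).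
by rewrite /Rintegral integral_indic// setIT.
Qed.

End FiniteMeasure.

Lemma daniell_charge_integral (nu : {charge set X -> \bar R}) :
  daniell (charge_integral nu).
Proof.
rewrite /charge_integral; case: cid => P PN; case: cid => N nuPN.
apply: daniellB.
- exact: (daniell_complex_integral (jordan_pos nuPN)).
- exact: (daniell_complex_integral (jordan_neg nuPN)).
Qed.

Lemma charge_integral_indic (nu : {charge set X -> \bar R}) A : measurable A ->
  charge_integral nu (cindic A) = (fine (nu A))%:C.
Proof.
move=> mA; rewrite /charge_integral; case: cid => P PN; case: cid => N nuPN.
rewrite (complex_integral_indic (jordan_pos nuPN))// (complex_integral_indic (jordan_neg nuPN))//.
rewrite -rmorphB/=; congr (_%:C).
rewrite (jordan_decomp nuPN mA) /cadd/= cscaleN1 fineB ?fin_num_measure//.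
Qed.

Local Notation M := (complex_measure X R).
Local Notation Int := (@integral_complex_measure _ X R).

Lemma daniell_Int (m : M) : daniell (Int m).
Proof.
have := daniell_lin 'i (daniell_charge_integral (Im_measure m))
  (daniell_charge_integral (Re_measure m)).
by congr daniell; apply/funext => f; rewrite addrC.
Qed.

Lemma Int_indic (m : M) A : measurable A -> Int m (cindic A) = m A.
Proof.
move=> mA; rewrite /integral_complex_measure !charge_integral_indic//=.
by rewrite -complexE.
Qed.

(** Hahn decompositions of different measures are unrelated, so linearity in the
    measure is not visible on the definition of the integral; it holds because
    it holds on indicators. *)
Lemma Int_linear (c : R[i]) (m1 m2 : M) f : bmeas f ->
  Int (c *: m1 + m2) f = c * Int m1 f + Int m2 f.
Proof.
move: f; apply: daniell_eq; first exact: daniell_Int.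
  by apply: daniell_lin; exact: daniell_Int.
by move=> A mA; rewrite !Int_indic.
Qed.

Lemma Int_of_finite (m : {finite_measure set X -> \bar R}) f : bmeas f ->
  Int (of_finite_measure m) f = complex_integral m setT f.
Proof.
move: f; apply: daniell_eq; first exact: daniell_Int.
  exact: daniell_complex_integral.
move=> A mA; rewrite Int_indic// complex_integral_indic//.
by rewrite /of_finite_measure/= /of_finite_measure_fun asboolT.
Qed.

End BoundedMeasurable.

(** * Integration on metric spaces *)

Section MetricBorel.
Context (R : realType) (E : pointedMetricType R).
Implicit Types (f g : E -> R[i]) (A U F : set E) (x y : E).

Local Notation bmeasE := (@bmeas _ (borel E) R).
Local Notation Int := (@integral_complex_measure _ (borel E) R).

Lemma open_borel (U : set E) : open U -> measurable (U : set (borel E)).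
Proof. by move=> oU; exact: sub_sigma_algebra. Qed.

Lemma continuous_borel (u : E -> R) : continuous u ->
  measurable_fun setT (u : borel E -> R).
Proof.
move=> /continuousP cu; apply: (measurability _ (RGenOpens.measurableE R)).
move=> _ [_ [a [b ->] <-]]; rewrite setTI; apply: open_borel; apply: cu.
exact: interval_open.
Qed.

Lemma continuous_Re : continuous (fun z : R[i] => Re z).
Proof. by move=> z; have /cvg_complexP[] := @cvg_id _ (nbhs z). Qed.

Lemma continuous_Im : continuous (fun z : R[i] => Im z).
Proof. by move=> z; have /cvg_complexP[] := @cvg_id _ (nbhs z). Qed.

Lemma continuous_real_complex (T : topologicalType) (u : T -> R) : continuous u ->
  continuous (fun t => (u t)%:C).
Proof.
move=> cu x; apply/cvg_complexP; split => /=; first exact: cu.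
exact: cvg_cst.
Qed.

Lemma Cb_bmeas f : Cb f -> bmeasE f.
Proof.
move=> [cf bf]; split => //.
- by apply: continuous_borel => x; have /cvg_complexP[] := cf x.
- by apply: continuous_borel => x; have /cvg_complexP[] := cf x.
Qed.

Lemma continuous_borel_to_real (w : R[i] -> R) : continuous w ->
  measurable_fun setT (w : borel R[i] -> R).
Proof.
move=> /continuousP cu; apply: (measurability _ (RGenOpens.measurableE R)).
move=> _ [_ [a [b ->] <-]]; rewrite setTI; apply: sub_sigma_algebra; apply: cu.
exact: interval_open.
Qed.

Lemma Bb_bmeas f : Bb f -> bmeasE f.
Proof.
move=> [mf bf]; split => //.
- exact: (measurableT_comp (continuous_borel_to_real continuous_Re) mf).
- exact: (measurableT_comp (continuous_borel_to_real continuous_Im) mf).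
Qed.

Lemma Bb_cindic A : measurable (A : set (borel E)) -> Bb (cindic A : E -> R[i]).
Proof.
move=> mA; split; last by have [_ _] := @bmeas_indic _ _ R _ mA.
have mC : measurable_fun setT (real_complex R : R -> borel R[i]).
  apply: (@measurability _ _ R (borel R[i]) setT _ (@open R[i])) => // _ [U oU <-].
  rewrite setTI; apply: open_measurable.
  by move: U oU; apply/continuousP; apply: continuous_real_complex => x; exact: cvg_id.
have m1 : measurable_fun setT (\1_A : borel E -> R) by exact: measurable_indic.
exact: (measurableT_comp mC m1).
Qed.

Lemma Cb_cst (c : R[i]) : Cb (cst c : E -> R[i]).
Proof. by split; [exact: cst_continuous|exists (normc c)]. Qed.

Lemma Cb_lin (c : R[i]) f g : Cb f -> Cb g -> Cb (fun x => c * f x + g x).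
Proof.
move=> cf cg; split; last by have [_ _] := bmeas_lin c (Cb_bmeas cf) (Cb_bmeas cg).
move=> x; apply: cvgD; last exact: cg.1.
by apply: cvgM; [exact: cvg_cst|exact: cf.1].
Qed.

Lemma CbM f g : Cb f -> Cb g -> Cb (fun x => f x * g x).
Proof.
move=> [cf [M fM]] [cg [N gN]]; split; first by move=> x; apply: cvgM; [exact: cf|exact: cg].
exists (M * N) => x; rewrite Normc.normcM ler_pM ?normc_ge0//.
Qed.

Lemma Cb_real (u : E -> R) (M : R) : continuous u -> (forall x, `|u x| <= M) ->
  Cb (fun x => (u x)%:C).
Proof.
move=> cu uM; split; first exact: continuous_real_complex.
by exists M => x; rewrite normc_real.
Qed.

Lemma lipschitz_continuous (u : E -> R) :
  (forall x y, u y <= u x + mdist x y) -> continuous u.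
Proof.
move=> uL x; apply/cvgrPdist_lt => e e0.
have : nbhs x (ball x e) by exact: nbhsx_ballx.
rewrite ballEmdist; apply: filterS => y /= xy.
rewrite ltr_norml; apply/andP; split.
  by rewrite ltrNl opprB ltrBlDl; exact: le_lt_trans (uL x y) (ler_ltD _ xy).
by rewrite ltrBlDl; apply: le_lt_trans (uL y x) _; rewrite metric_sym ltrD2l.
Qed.

Lemma mdist_continuous x : continuous (mdist x).
Proof. by apply: lipschitz_continuous => y z; exact: metric_triangle. Qed.

(** The functions [min 1 (n d(x, F))], with [F] the complement of [U], increase
    to the indicator; if [F] is empty the constant 1 serves. *)
Lemma open_indic_limit U : open U ->
  exists2 f_ : nat -> E -> R[i], (forall n, Cb (f_ n)) &
    @bounded_cvg _ (borel E) R f_ (cindic U).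
Proof.
move=> oU; have [[z0 Uz0]|UT] := pselect (exists z, ~ U z); last first.
  have {}UT : U = setT.
    by rewrite predeqE => x; split=> // _; apply: contrapT => Ux; apply: UT; exists x.
  exists (fun _ => cst 1) => [n|]; first exact: Cb_cst.
  split; first by exists 1 => n x; rewrite /cst Normc.normc1.
  by move=> x; rewrite UT /cindic indicT; exact: cvg_cst.
pose S x := [set mdist x z | z in ~` U].
pose D x := inf (S x).
have Sn x : S x !=set0 by exists (mdist x z0); exists z0.
have Sb x : has_lbound (S x) by exists 0 => _ [z _ <-]; exact: mdist_ge0.
have D0 x : 0 <= D x by apply: lb_le_inf => // _ [z _ <-]; exact: mdist_ge0.
have cD : continuous D.
  apply: lipschitz_continuous => x y; rewrite -lerBlDr.
  apply: lb_le_inf => // _ [z Uz <-]; rewrite lerBlDr.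
  apply: le_trans (_ : mdist y z <= _).
    by apply: ge_inf => //; exists z.
  by rewrite addrC (metric_sym x); exact: metric_triangle.
have D_in x : U x -> 0 < D x.
  move=> Ux; have : nbhs x U by exact: open_nbhs_nbhs.
  rewrite -(@filter_from_ballE R E) => -[e /= e0 eU]; apply: lt_le_trans e0 _.
  apply: lb_le_inf => // _ [z Uz <-]; rewrite leNgt; apply/negP => xz.
  by apply: Uz; apply: eU; rewrite ballEmdist.
have D_out x : ~ U x -> D x = 0.
  move=> Ux; apply/eqP; rewrite eq_le D0 andbT; apply: ge_inf => //.
  by exists x => //; exact: mdistxx.
pose f_ (n : nat) (x : E) : R[i] := (Num.min 1 (n%:R * D x))%:C.
have f_bd n x : `|Num.min 1 (n%:R * D x)| <= 1.
  by rewrite ger0_norm ?ge_min ?lexx// le_min ler01 mulr_ge0.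
exists f_ => [n|].
  apply: Cb_real (f_bd n) => x.
  apply: (@continuous_min _ _ (cst 1) (fun x => n%:R * D x)); first exact: cvg_cst.
  by apply: cvgM; [exact: cvg_cst|exact: cD].
split; first by exists 1 => n x; rewrite normc_real.
move=> x; apply: real_complex_cvg; rewrite indicE.
have [Ux|Ux] := pselect (U x); last first.
  rewrite memNset//; under eq_fun do rewrite D_out// mulr0 min_r//.
  exact: cvg_cst.
rewrite mem_set//=; apply: (@cvg_trans _ (cst (1:R) @ \oo)); last exact: cvg_cst.
apply: near_eq_cvg; near=> n.
rewrite /= min_l// -ler_pdivrMr ?D_in// mul1r.
near: n; exact: nbhs_infty_ger.
Unshelve. all: by end_near. Qed.

Section InductionCb.
Variable H : (E -> R[i]) -> Prop.
Hypothesis H_Cb : forall f, Cb f -> H f.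
Hypothesis Hlin : forall (c : R[i]) f g, bmeasE f -> bmeasE g -> H f -> H g ->
  H (fun x => c * f x + g x).
Hypothesis Hcvg : forall (f_ : nat -> E -> R[i]) f,
  (forall n, bmeasE (f_ n)) -> (forall n, H (f_ n)) ->
  @bounded_cvg _ (borel E) _ f_ f -> H f.

(** Functional monotone class principle, from bounded continuous functions: the
    sets whose indicator satisfies [H] form a Dynkin system, and it contains the
    open sets, which are stable under intersection. *)
Lemma bmeas_ind_Cb f : bmeasE f -> H f.
Proof.
apply: (@bmeas_ind _ (borel E) R H) => // A mA.
suff: forall S, <<s (@open E) >> S -> H (cindic S) by exact.
clear A mA.
apply: (@dynkin_induction _ (borel E) (@open E) (fun A => H (cindic A))).
- by [].
- by move=> ? ?; exact: openI.
- have := H_Cb (Cb_cst 1); congr H; apply/funext => x.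
  by rewrite /cindic indicT.
- move=> U oU; have [f_ cf ff] := open_indic_limit oU.
  by apply: Hcvg ff => n; [exact: Cb_bmeas|exact: H_Cb].
- move=> S mS HS; have := Hlin (-1) (bmeas_indic _ mS) (Cb_bmeas (Cb_cst 1)) HS (H_Cb (Cb_cst 1)).
  congr H; apply/funext => x; rewrite /cindic !indicE in_setC /=.
  by case: (x \in S); rewrite /= ?mulr1 ?mulr0 ?addNr ?add0r.
move=> F mF tF HF.
have HS n : H (fun x => \sum_(k < n) cindic (F k) x) /\
    bmeasE (fun x => \sum_(k < n) cindic (F k) x).
  elim: n => [|n [IH1 IH2]].
    have -> : (fun x => \sum_(k < 0) cindic (F k) x) = cst (0 : R[i]).
      by apply/funext => x; rewrite big_ord0.
    by split; [exact: H_Cb (Cb_cst 0)|exact: (Cb_bmeas (Cb_cst 0))].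
  have -> : (fun x => \sum_(k < n.+1) cindic (F k) x) =
      (fun x => 1 * cindic (F n) x + \sum_(k < n) cindic (F k) x :> R[i]).
    by apply/funext => x; rewrite big_ord_recr/= addrC mul1r.
  split; first by apply: Hlin => //; exact: bmeas_indic.
  by apply: bmeas_lin => //; exact: bmeas_indic.
have sumF n x : \sum_(k < n) cindic (F k) x =
    (`[< exists2 k, (k < n)%N & F k x >])%:R :> R[i].
  case: asboolP => [[k kn Fkx]|nF].
    rewrite (bigD1 (Ordinal kn))//= big1 ?addr0.
      by rewrite /cindic indicE mem_set.
    move=> i ik; rewrite /cindic indicE memNset// => Fix.
    have /eqP : nat_of_ord i <> k by move=> ik'; move/eqP: ik; apply; exact: val_inj.
    by move/(trivIsetP.1 tF i k I I)/seteqP => -[/(_ x) FF _]; apply: FF; split.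
  rewrite big1// => i _; rewrite /cindic indicE memNset// => Fix; apply: nF.
  by exists i.
apply: (Hcvg (fun n => (HS n).2) (fun n => (HS n).1)); split.
  exists 1 => n x; rewrite sumF; case: asboolP => _; rewrite ?Normc.normc1 ?Normc.normc0//.
move=> x; rewrite /cindic indicE.
have [[k _ Fkx]|nF] := pselect ((\bigcup_k F k) x).
  rewrite mem_set; last by exists k.
  apply: (@cvg_trans _ (cst (1:R[i]) @ \oo)); last exact: cvg_cst.
  apply: near_eq_cvg; near=> n; rewrite sumF asboolT//; exists k => //.
  by near: n; exists k.+1.
rewrite memNset//.
have -> : (fun n => \sum_(k < n) cindic (F k) x) = cst (0 : R[i]).
  apply/funext => n; rewrite sumF asboolF// => -[k _ Fkx]; apply: nF.
  by exists k.
exact: cvg_cst.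
Unshelve. all: by end_near. Qed.

End InductionCb.

Lemma Int0 m : Int m (cst 0) = 0.
Proof.
have := (daniell_Int m).1 (-1) _ _ (@bmeas_cst _ (borel E) R 0) (@bmeas_cst _ (borel E) R 0).
rewrite mulN1r addNr => E0; rewrite -[RHS]E0; congr (integral_complex_measure _ _).
by apply/funext => x /=; rewrite mulr0 addr0.
Qed.

Lemma IntZ m c f : bmeasE f -> Int m (fun x => c * f x) = c * Int m f.
Proof.
move=> bf; have := (daniell_Int m).1 c _ _ bf (@bmeas_cst _ (borel E) R 0).
rewrite Int0 addr0 => <-; congr (integral_complex_measure _ _); apply/funext => x.
by rewrite addr0.
Qed.

Lemma IntB m f g : bmeasE f -> bmeasE g ->
  Int m (fun x => f x - g x) = Int m f - Int m g.
Proof.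
move=> bf bg; rewrite addrC -mulN1r -(daniell_Int m).1//.
by congr (integral_complex_measure _ _); apply/funext => x; rewrite mulN1r addrC.
Qed.

Lemma fine_probability_setT (P : probability (borel E) R) :
  fine ((P : {measure set (borel E) -> \bar R}) setT) = 1.
Proof. exact: (congr1 fine (probability_setT P)). Qed.

Lemma Int_cst (P : probability (borel E) R) (c : R[i]) :
  Int (of_finite_measure P) (cst c) = c.
Proof.
rewrite Int_of_finite; last exact: bmeas_cst.
by rewrite /complex_integral /cst !Rintegral_cst// fine_probability_setT !mulr1; case: c.
Qed.


(** Multiplying by a unimodular constant makes the integral real and nonnegative;
    bounding the two parts separately would lose a factor. *)
Lemma normc_Int (P : probability (borel E) R) f (v : E -> R) (M : R) : bmeasE f ->
  measurable_fun setT (v : borel E -> R) -> (forall x, `|v x| <= M) ->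
  (forall x, normc (f x) <= v x) ->
  normc (Int (of_finite_measure P) f) <= \int[P]_(x in setT) v x.
Proof.
move=> bf mv vM fv; set z := Int _ f; have [z0|z0] := eqVneq z 0.
  rewrite z0 Normc.normc0; apply: Rintegral_ge0 => x _.
  exact: le_trans (normc_ge0 _) (fv x).
pose u : R[i] := z^-1 * (normc z)%:C.
have nz : normc z != 0 by rewrite normc_eq0.
have u1 : normc u = 1.
  by rewrite Normc.normcM Normc.normcV normc_real ger0_norm ?normc_ge0// mulVf.
have uz : u * z = (normc z)%:C by rewrite /u mulrAC mulVf// mul1r.
have bu : bmeasE (fun x => u * f x) by exact: bmeasZ.
have uE : Int (of_finite_measure P) (fun x => u * f x) = (normc z)%:C.
  by rewrite -uz -IntZ.
have -> : normc z = Re ((normc z)%:C) by [].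
rewrite -uE Int_of_finite//=.
have [mu _ [N uN]] := bu.
have iu := bounded_integrable P mu (fun x => le_trans (Re_le_normc _) (uN x)).
apply: le_Rintegral => //; first exact: (bounded_integrable P mv vM).
move=> x _; apply: le_trans (ler_norm _) _; apply: le_trans (Re_le_normc _) _.
by rewrite Normc.normcM u1 mul1r.
Qed.

Lemma Int_probability (P : probability (borel E) R) f (M : R) : bmeasE f ->
  (forall x, normc (f x) <= M) -> normc (Int (of_finite_measure P) f) <= M.
Proof.
move=> bf fM; have M0 : 0 <= M by apply: le_trans (fM point); exact: normc_ge0.
apply: le_trans (normc_Int P (v := fun=> M) (M := M) bf _ _ fM) _ => //.
  by move=> x; rewrite ger0_norm.
by rewrite Rintegral_cst// fine_probability_setT mulr1.
Qed.

Lemma delta_indic x A : measurable (A : set (borel E)) -> delta x A = cindic A x.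
Proof.
by move=> mA; rewrite /delta /of_finite_measure/= /of_finite_measure_fun asboolT//.
Qed.

Lemma Int_delta x f : bmeasE f -> Int (delta x) f = f x.
Proof.
move: f; apply: (@daniell_eq _ (borel E) R _ (fun f => f x)); first exact: daniell_Int.
- by split=> [//|f_ f _ [_]].
- by move=> A mA; rewrite Int_indic// delta_indic.
Qed.

End MetricBorel.

(** * Weak continuity forces finite rank *)

Section KerSpan.
Context (K : fieldType) (V : lmodType K) (I : eqType).

Definition linear_form (phi : V -> K) :=
  forall c u v, phi (c *: u + v) = c * phi u + phi v.

(** By induction on [s]: if the head [ev i] does not vanish on the common kernel
    of the tail, subtracting a multiple of it from [phi] reduces to the tail.
    The span of the forms [ev i] is replaced by an arbitrary set [S] of forms
    stable under combinations, which will be the set of integrals of functions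
    in [Cb]. *)
Lemma ker_span (ev : I -> V -> K) (S : (V -> K) -> Prop) (s : seq I) :
  (forall i, linear_form (ev i)) ->
  S (fun=> 0) ->
  (forall c g h, S g -> S h -> S (fun v => c * g v + h v)) ->
  (forall i, i \in s -> S (ev i)) ->
  forall phi, linear_form phi ->
  (forall v, (forall i, i \in s -> ev i v = 0) -> phi v = 0) ->
  S phi.
Proof.
move=> evL S0 SL; elim: s => [|i s IH] Ss phi phiL ker.
  by congr S: S0; apply/funext => v; rewrite ker.
have {}IH := IH (fun j js => Ss j (mem_behead (s := i :: s) js)).
have [[v0 [v0s v0i]]|no] := pselect (exists v0,
    (forall j, j \in s -> ev j v0 = 0) /\ ev i v0 <> 0); last first.
  apply: IH => // v vs; apply: ker => j; rewrite inE => /predU1P[->|/vs//].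
  by apply: contrapT => vi; apply: no; exists v.
move/eqP in v0i; pose k := phi v0 / ev i v0.
have -> : phi = (fun v => k * ev i v + (phi v - k * ev i v)).
  by apply/funext => v; rewrite addrC subrK.
apply: SL; first by apply: Ss; rewrite mem_head.
apply: IH => [c u v|v vs]; first by rewrite phiL evL; ring.
have Z : phi (- (ev i v / ev i v0) *: v0 + v) = 0.
  apply: ker => j; rewrite inE evL => /predU1P[->|js].
    by rewrite mulNr divfK// addNr.
  by rewrite (v0s j js) mulr0 add0r vs.
rewrite phiL in Z; rewrite -[RHS]Z /k; field.
exact: v0i.
Qed.

End KerSpan.

Section PointwiseTopology.
Context (I : Type) (V : topologicalType).

Lemma cvg_ptws (T : Type) (F : set_system T) {FF : Filter F} (h : T -> I -> V) (f : I -> V) :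
  (forall i, h t i @[t --> F] --> f i) -> {ptws, h @ F --> f}.
Proof.
move=> hf; apply/cvg_sup => i U [B] [[C oC <-] Cf BU].
apply: (filterS BU); apply: (hf i); exact: open_nbhs_nbhs.
Qed.

Lemma ptws_eval_continuous i :
  continuous (fun f : {ptws I -> V} => f i).
Proof.
move=> f; have /cvg_sup/(_ i) : (f : {ptws I -> V}) --> f by exact: cvg_id.
move=> H; apply: (cvg_trans _ (@initial_continuous _ _ (fun g : I -> V => g i) f)).
by apply: cvg_fmap2; exact: H.
Qed.

End PointwiseTopology.

Section WeakTopology.
Context (R : realType) (E : pointedMetricType R).
Local Notation M := (complex_measure (borel E) R).
Local Notation W := (@weak_measure R E).
Local Notation bmeasE := (@bmeas _ (borel E) R).
Local Notation Int := (@integral_complex_measure _ (borel E) R).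
Implicit Types (f g : E -> R[i]) (mu nu : M).

Lemma Int_zero f : bmeasE f -> Int 0 f = 0.
Proof.
move=> bf; have := Int_linear (-1) (0 : M) (0 : M) bf.
by rewrite scaleN1r addNr mulN1r addNr.
Qed.

Lemma Int_scale c mu f : bmeasE f -> Int (c *: mu) f = c * Int mu f.
Proof. by move=> bf; rewrite -[c *: mu]addr0 Int_linear// Int_zero// addr0. Qed.

(** Integration of [f], made linear in the measure for every [f] by the value 0
    outside [Cb]. *)
Definition weak_form f mu : R[i] := if `[< Cb f >] then Int mu f else 0.

Lemma weak_formE f mu : Cb f -> weak_form f mu = Int mu f.
Proof. by move=> cf; rewrite /weak_form asboolT. Qed.

Lemma weak_form_linear f : @linear_form _ M (weak_form f).
Proof.
move=> c u v; rewrite /weak_form; case: asboolP => [/Cb_bmeas bf|_].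
  by rewrite Int_linear.
by rewrite mulr0 addr0.
Qed.

Definition weak_nbhs0 : set_system M :=
  [set A | exists fs : seq (E -> R[i]), exists2 e : R, 0 < e &
     (forall f, f \in fs -> Cb f) /\
     forall mu, (forall f, f \in fs -> normc (Int mu f) < e) -> A mu].

Lemma weak_nbhs0_filter : Filter weak_nbhs0.
Proof.
split.
- by exists [::], 1.
- move=> A B [fs [e e0 [cf fA]]] [gs [e' e'0 [cg gB]]].
  exists (fs ++ gs), (Num.min e e'); first by rewrite lt_min e0.
  split=> [f|mu fgmu]; first by rewrite mem_cat => /orP[/cf|/cg].
  split; [apply: fA|apply: gB] => f ff; have := fgmu f;
    by rewrite mem_cat ff ?orbT => /(_ isT); rewrite lt_min => /andP[].
- move=> A B AB [fs [e e0 [cf fA]]]; exists fs, e => //; split=> // mu fmu.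
  exact/AB/fA.
Qed.

(** Integration of each function of [Cb] converges along the filter
    [weak_nbhs0], so this filter converges to 0; every weak neighborhood of 0
    is therefore controlled by finitely many test functions. *)
Lemma weak_nbhs0_cvg (A : set W) : nbhs ((0 : M) : W) A -> weak_nbhs0 A.
Proof.
have FW := weak_nbhs0_filter.
suff cW : (@pairing R E) @ weak_nbhs0 --> @pairing R E 0.
  move=> [_ [[B oB <-] B0 BA]].
  have /cW : nbhs (@pairing R E 0) B by exact: open_nbhs_nbhs.
  exact: filterS BA.
apply: cvg_ptws => -[f cf]; rewrite /pairing/=.
rewrite Int_zero; last exact: Cb_bmeas.
apply/cvg_normcP => e e0; exists [:: f], e => //; split.
  by move=> g; rewrite inE => /eqP ->.
by move=> mu /(_ f (mem_head _ _)); rewrite subr0.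
Qed.

Lemma weak_nbhs0_ball f : Cb f ->
  nbhs ((0 : M) : W) [set mu : M | normc (Int mu f) < 1].
Proof.
move=> cf.
have c : (fun mu : W => Int (mu : M) f) x @[x --> ((0 : M) : W)] --> Int 0 f :=
  continuous_comp (@initial_continuous _ _ (@pairing R E) ((0 : M) : W))
  (@ptws_eval_continuous _ _ (exist _ f cf) _).
move: c; rewrite Int_zero; last exact: Cb_bmeas.
by move=> /cvg_normcP/(_ 1 ltr01); apply: filterS => mu /=; rewrite subr0.
Qed.

Section Operator.
Variable op : M -> M -> M.
Hypothesis op_bilinear : bilinear_op op.
Hypothesis op_continuous : weakly_continuous_op op.

Lemma op0l nu : op 0 nu = 0.
Proof.
have := op_bilinear.1 nu (-1) 0 0.
by rewrite !scaleN1r !addNr.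
Qed.

Lemma opZl c mu nu : op (c *: mu) nu = c *: op mu nu.
Proof. by rewrite -[c *: mu]addr0 op_bilinear.1 op0l addr0. Qed.

Lemma op0r mu : op mu 0 = 0.
Proof.
have := op_bilinear.2 mu (-1) 0 0.
by rewrite !scaleN1r !addNr.
Qed.

Lemma opZr c mu nu : op mu (c *: nu) = c *: op mu nu.
Proof. by rewrite -[c *: nu]addr0 op_bilinear.2 op0r addr0. Qed.

(** Joint continuity at the origin gives [|(mu op nu)(f)| < 1] as soon as finitely
    many integrals of [mu], and finitely many of [nu], are small. If the former
    vanish then [mu] may be multiplied by any scalar, which forces
    [(mu op nu)(f) = 0]: the bilinear form [(mu, nu) |-> (mu op nu)(f)] has finite
    rank. *)
Lemma op_finite_rank f : Cb f ->
  exists fs : seq (E -> R[i]), (forall g, g \in fs -> Cb g) /\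
    forall mu, (forall g, g \in fs -> weak_form g mu = 0) ->
    forall nu, Int (op mu nu) f = 0.
Proof.
move=> cf; have bf := Cb_bmeas cf.
have := @op_continuous ((0 : M) : W, (0 : M) : W) [set mu : M | normc (Int mu f) < 1].
rewrite /= op0l => /(_ (weak_nbhs0_ball cf)).
case=> -[A B] /= [/weak_nbhs0_cvg [fs [e e0 [cfs fA]]]].
move=> /weak_nbhs0_cvg [gs [e' e'0 [cgs gB]]] AB.
exists fs; split=> // mu mu0 nu.
(* [nu] is shrunk into [B], and [mu] is then scaled so that the product has
   integral exactly 1, against the strict bound given by [AB]. *)
pose L := \sum_(g <- gs) normc (Int nu g) + 1.
have L0 : 0 < L by rewrite ltr_pwDr// sumr_ge0// => g _; exact: normc_ge0.
pose k : R := e' / L.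
have k0 : 0 < k by rewrite divr_gt0.
have Bnu : B (k%:C *: nu).
  apply: gB => g gg; rewrite Int_scale; last exact/Cb_bmeas/cgs.
  rewrite Normc.normcM normc_real gtr0_norm// /k mulrAC ltr_pdivrMr// ltr_pM2l//.
  by rewrite /L (big_rem g gg)/= -addrA ltr_pwDr// ltr_wpDl// sumr_ge0// => ? _; exact: normc_ge0.
apply: contrapT => /eqP nz.
pose z := Int (op mu nu) f.
pose c : R[i] := z^-1 / k%:C.
have Amu : A (c *: mu).
  apply: fA => g gg; rewrite Int_scale; last exact/Cb_bmeas/cfs.
  by rewrite -weak_formE ?mu0 ?mulr0 ?Normc.normc0//; exact: cfs.
have := AB (c *: mu, k%:C *: nu) (conj Amu Bnu).
rewrite /= opZl opZr !Int_scale// -/z mulrA divfK ?mulVf ?Normc.normc1 ?ltxx//.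
by rewrite (inj_eq (@complexI R) _ 0) gt_eqF.
Qed.

(** The generalized translation of [f] by [nu]; for the convolution semigroup it
    is [T_t f = translate (gamma t) f]. *)
Definition translate nu f : E -> R[i] := fun x => Int (op (delta x) nu) f.

(** The form [mu |-> (mu op nu)(f)] is weakly continuous, hence a combination of
    integrals of functions in [Cb], hence the integral of one such function;
    testing it on unit masses identifies this function with the translate. *)
Lemma translate_Cb nu f : Cb f ->
  Cb (translate nu f) /\ forall mu, Int (op mu nu) f = Int mu (translate nu f).
Proof.
move=> cf; have bf := Cb_bmeas cf.
have [fs [cfs ker]] := op_finite_rank cf.
suff [g [cg gE]] : exists g, Cb g /\ forall mu, Int (op mu nu) f = Int mu g.
  have -> : translate nu f = g.
    by apply/funext => x; rewrite /translate gE Int_delta//; exact: Cb_bmeas.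
  by [].
pose S (phi : M -> R[i]) := exists g, Cb g /\ forall mu, phi mu = Int mu g.
apply: (@ker_span _ M _ weak_form S fs weak_form_linear _ _ _
  (fun mu => Int (op mu nu) f)).
- by exists (cst 0); split=> [|mu]; [exact: Cb_cst|rewrite Int0].
- move=> c phi psi [g [cg gE]] [h [ch hE]].
  exists (fun x => c * g x + h x); split=> [|mu]; first exact: Cb_lin.
  by rewrite gE hE (daniell_Int mu).1//; exact: Cb_bmeas.
- by move=> g gs; exists g; split=> [|mu]; [|rewrite weak_formE//]; exact: cfs.
- by move=> c u v; rewrite op_bilinear.1 Int_linear.
- by move=> mu mu0; exact: ker.
Qed.

Hypothesis op_probability : preserves_probability op.

Lemma delta_op_probability x (P : probability (borel E) R) :
  exists rho : probability (borel E) R,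
    op (delta x) (of_finite_measure P) = of_finite_measure rho.
Proof. exact: (op_probability (@dirac _ (borel E) x R) P). Qed.

(** Disintegration [(mu op P)(f) = \int (delta x op P)(f) mu(dx)], extended from
    [Cb] by the monotone class principle; [P] and each [delta x op P] being
    probabilities, translation preserves bounds. *)
Lemma translate_bmeas (P : probability (borel E) R) f : bmeasE f ->
  bmeasE (translate (of_finite_measure P) f) /\
  forall mu, Int (op mu (of_finite_measure P)) f =
             Int mu (translate (of_finite_measure P) f).
Proof.
move: f; apply: bmeas_ind_Cb.
- by move=> f cf; have [c H] := translate_Cb (of_finite_measure P) cf; split=> //; exact: Cb_bmeas.
- move=> c f g bf bg [bTf Tf] [bTg Tg].
  have -> : translate (of_finite_measure P) (fun x => c * f x + g x) =
      (fun x => c * translate (of_finite_measure P) f x + translate (of_finite_measure P) g x).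
    by apply/funext => x; rewrite /translate (daniell_Int _).1.
  split; first exact: bmeas_lin.
  by move=> mu; rewrite !(daniell_Int _).1// Tf Tg.
move=> f_ f bf Hf ff; have bf' := bmeas_cvg bf ff.
have Tff : @bounded_cvg _ (borel E) _ (fun n => translate (of_finite_measure P) (f_ n))
    (translate (of_finite_measure P) f).
  split; last by move=> x; exact: (daniell_Int _).2.
  have [[N fN] _] := ff; exists N => n x; rewrite /translate.
  have [rho ->] := delta_op_probability x P.
  exact: Int_probability.
split; first by apply: bmeas_cvg Tff => n; exact: (Hf n).1.
move=> mu.
apply: (@cvg_unique _ (@norm_hausdorff _ R[i]) _ _ _ _ ((daniell_Int _).2 _ _ bf ff)).
have -> : (fun n => Int (op mu (of_finite_measure P)) (f_ n)) =
    (fun n => Int mu (translate (of_finite_measure P) (f_ n))).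
  by apply/funext => n; exact: (Hf n).2.
by apply: (daniell_Int mu).2 Tff => n; exact: (Hf n).1.
Qed.

End Operator.
End WeakTopology.

(** * Finite-dimensional quotients of the convolution algebra *)

Section FiniteRankAlgebra.
Context (K : fieldType) (V : lmodType K).
Variables (op : V -> V -> V) (e : V).
Hypothesis opl : forall c u v w, op (c *: u + v) w = c *: op u w + op v w.
Hypothesis opr : forall c u v w, op w (c *: u + v) = c *: op w u + op w v.
Hypothesis opA : associative op.
Hypothesis opC : commutative op.
Hypothesis op1 : left_id e op.
Variable l : V -> K.
Hypothesis l_lin : linear_form l.

Lemma linear_form_sum (phi : V -> K) (I : finType) (c : I -> K) (u : I -> V) :
  linear_form phi -> phi (\sum_i c i *: u i) = \sum_i c i * phi (u i).
Proof.
move=> phiL; have phi0 : phi 0 = 0.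
  by have := phiL (-1) 0 0; rewrite scaler0 addr0 mulN1r addNr.
elim/big_rec2: _ => [//|i y x _ <-]; exact: phiL.
Qed.

(** Invertibility modulo the ideal of the [v] such that [l (op u v) = 0] for
    all [u]. *)
Definition weakly_invertible (g : V) : Prop :=
  exists k, forall u, l (op u (op g k)) = l u.

Lemma weakly_invertibleM g h :
  weakly_invertible g -> weakly_invertible h -> weakly_invertible (op g h).
Proof.
move=> [k kE] [j jE]; exists (op k j) => u.
have -> : op (op g h) (op k j) = op (op g k) (op h j).
  by rewrite -!opA; congr op; rewrite !opA (opC h).
by rewrite opA jE kE.
Qed.

Definition form_mx n (g : V) (x y : 'I_n -> V) : 'M[K]_n :=
  \matrix_(i, j) l (op (x i) (op g (y j))).

Definition has_minor n := exists x y : 'I_n -> V, \det (form_mx e x y) != 0.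

Variables (I : eqType) (ev : I -> V -> K) (s : seq I).
Hypothesis ev_lin : forall i, linear_form (ev i).
Hypothesis l_ker : forall u, (forall i, i \in s -> ev i u = 0) ->
  forall v, l (op u v) = 0.

(** In a larger matrix some nontrivial combination of the [x i] is killed by all
    the forms [ev i], and gives a relation between the rows. *)
Lemma has_minor_bound n : has_minor n -> (n <= size s)%N.
Proof.
move=> [x [y dxy]]; rewrite leqNgt; apply/negP => sn.
pose Q := \matrix_(i < n, j < size s) ev (tnth (in_tuple s) j) (x i).
have /rowV0Pn[v /sub_kermxP vQ v0] : kermx Q != 0.
  rewrite -mxrank_eq0 mxrank_ker subn_eq0 -ltnNge.
  exact: leq_ltn_trans (rank_leq_col _) sn.
have uD : form_mx e x y \in unitmx by rewrite unitmxE unitfE.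
suff vD : v *m form_mx e x y = 0.
  by move/eqP: v0; apply; rewrite -[v](mulmxK uD) vD mul0mx.
apply/matrixP => i j; rewrite !mxE.
have L : linear_form (fun u => l (op u (op e (y j)))).
  by move=> c u w; rewrite opl l_lin.
under eq_bigr do rewrite mxE.
rewrite -(linear_form_sum (v i) x L); apply: l_ker => k ks.
rewrite linear_form_sum//.
have /tnthP[k' ->] : k \in in_tuple s by [].
have /matrixP/(_ i k') := vQ; rewrite mxE [RHS]mxE => vQ0; rewrite -[RHS]vQ0.
by apply: eq_bigr => j' _; rewrite mxE.
Qed.

(** A nonsingular matrix of maximal size sees the whole quotient by that ideal.
    Given [g] with a nonsingular matrix, solving a linear system produces [k] such
    that [op g k] and [e] agree when paired with every [x i]. If they disagreed
    when paired with some [u], bordering the matrix by [u] and [op g k - e] would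
    produce a larger nonsingular one. *)
Lemma weakly_invertible_minor : exists n (x y : 'I_n -> V),
  \det (form_mx e x y) != 0 /\
  forall g, \det (form_mx g x y) != 0 -> weakly_invertible g.
Proof.
have ex0 : exists n, `[< has_minor n >].
  exists 0%N; apply/asboolP; exists (fun=> 0), (fun=> 0).
  by rewrite det_mx00 oner_neq0.
have bd n : `[< has_minor n >] -> (n <= size s)%N.
  by move=> /asboolP; exact: has_minor_bound.
have [n /asboolP[x [y dxy]] nmax] := ex_maxnP ex0 bd.
exists n, x, y; split=> // g dg.
have uD : form_mx g x y \in unitmx by rewrite unitmxE unitfE.
pose b := \col_i l (x i).
pose c := invmx (form_mx g x y) *m b.
pose k := \sum_j c j 0 *: y j.
exists k.
have xk i : l (op (x i) (op g k)) = l (x i).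
  have L : linear_form (fun u => l (op (x i) (op g u))).
    by move=> a u w; rewrite !opr l_lin.
  rewrite (linear_form_sum (c ^~ 0) y L).
  have : (form_mx g x y *m c) i 0 = b i 0 by rewrite mulKVmx.
  rewrite mxE [RHS]mxE => cE; rewrite -[RHS]cE.
  by apply: eq_bigr => j _; rewrite [LHS]mulrC; congr (_ * _); rewrite mxE.
move=> u; apply/eqP; rewrite -subr_eq0; apply: contraT => nz.
pose r := op g k - e.
have lr w : l (op w r) = l (op w (op g k)) - l w.
  by rewrite /r addrC -scaleN1r opr l_lin mulN1r addrC (opC w e) op1.
pose x' (i : 'I_n.+1) := if unlift ord0 i is Some j then x j else u.
pose y' (i : 'I_n.+1) := if unlift ord0 i is Some j then op g (y j) else r.
suff : `[< has_minor n.+1 >] by move/nmax; rewrite ltnn.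
apply/asboolP; exists x', y'.
have -> : form_mx e x' y' = @block_mx _ 1 n 1 n (l (op u r))%:M
    (\row_j l (op u (op g (y j)))) 0 (form_mx g x y).
  apply/matrixP => i j; rewrite !mxE op1 /x' /y'.
  case: splitP => i' ii'; rewrite mxE; case: splitP => j' jj'.
  - have -> : i = ord0 by apply/val_inj; rewrite /= ii' ord1.
    have -> : j = ord0 by apply/val_inj; rewrite /= jj' ord1.
    by rewrite !unlift_none mxE !ord1.
  - have -> : i = ord0 by apply/val_inj; rewrite /= ii' ord1.
    have -> : j = lift ord0 j' by apply/val_inj; rewrite /= jj'.
    by rewrite unlift_none liftK mxE.
  - have -> : j = ord0 by apply/val_inj; rewrite /= jj' ord1.
    have -> : i = lift ord0 i' by apply/val_inj; rewrite /= ii'.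
    by rewrite unlift_none liftK mxE lr xk subrr.
  - have -> : i = lift ord0 i' by apply/val_inj; rewrite /= ii'.
    have -> : j = lift ord0 j' by apply/val_inj; rewrite /= jj'.
    by rewrite !liftK mxE.
have dE := det_ublock (l (op u r))%:M (\row_j l (op u (op g (y j)))) (form_mx g x y).
apply/eqP => d0.
have : l (op u r) * \det (form_mx g x y) = 0.
  by rewrite -[RHS]d0 -[X in X * _]det_scalar1; exact: esym dE.
by apply/eqP; rewrite mulf_neq0// lr.
Qed.

End FiniteRankAlgebra.

Lemma cvg_det (K : numFieldType) (T : Type) (F : set_system T) {FF : Filter F} n
    (A : T -> 'M[K]_n) (B : 'M[K]_n) :
  (forall i j, A t i j @[t --> F] --> B i j) ->
  \det (A t) @[t --> F] --> \det B.
Proof.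
move=> AB; apply: cvg_big => [|s _].
  by move=> [x y]; exact: add_continuous.
apply: cvgM; first exact: cvg_cst.
apply: cvg_big => [|i _]; last exact: AB.
by move=> [x y]; exact: mul_continuous.
Qed.

(** * Feller semigroup: weak limit and bijectivity *)

Section VanishingAtInfinity.
Context (R : realType) (E : pointedMetricType R).
Implicit Types (f g : E -> R[i]) (x y : E).

Lemma C0_Cb f : C0 f -> Cb f.
Proof.
move=> [cf f0]; split=> //; have [K cK fK] := f0 1 ltr01.
have bd (u : E -> R) : continuous u -> exists N, forall x, K x -> `|u x| <= N.
  move=> cu; have /compact_bounded[N [_ uN]] : compact (u @` K).
    by apply: continuous_compact => //; exact: continuous_subspaceT.
  by exists (N + 1) => x Kx; apply: uN; [rewrite ltrDl|exists x].
have [N1 fN1] := bd _ (fun x => proj1 ((@cvg_complexP _ _ _ _ _ _).1 (cf x))).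
have [N2 fN2] := bd _ (fun x => proj2 ((@cvg_complexP _ _ _ _ _ _).1 (cf x))).
exists (Num.max 1 (N1 + N2)) => x; rewrite le_max.
have [Kx|/fK/ltW ->//] := pselect (K x).
apply/orP; right; apply: le_trans (normc_le_ReIm _) _.
by rewrite lerD ?fN1 ?fN2.
Qed.

Lemma normc_le_sup_norm f x : Cb f -> normc (f x) <= sup_norm f.
Proof.
move=> [_ [N fN]]; apply: sup_ubound; last by exists x.
by exists N => _ [y _ <-].
Qed.

Lemma C0_sub f g : C0 f -> C0 g -> C0 (f - g).
Proof.
move=> [cf f0] [cg g0]; split; first by move=> x; apply: cvgB; [exact: cf|exact: cg].
move=> e e0; have e2 : 0 < e / 2 by rewrite divr_gt0.
have [K cK fK] := f0 _ e2; have [L cL gL] := g0 _ e2.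
exists (K `|` L); first exact: compactU.
move=> x /not_orP[Kx Lx]; rewrite [e]splitr.
by rewrite (le_lt_trans (ler_normcD _ _))// ltrD ?normc_opp ?fK ?gL.
Qed.

(** The tent [max 0 (1 - d(x0, x) / r)] works when the ball of radius [r] is
    contained in a compact set. *)
Lemma C0_cutoff x0 : locally_compact [set: E] ->
  exists u : E -> R, [/\ continuous u, u x0 = 1, forall x, 0 <= u x <= 1 &
    forall f, Cb f -> C0 (fun x => f x * (u x)%:C)].
Proof.
move=> /(_ x0 I); rewrite withinET => -[K nK [cK _]].
move: nK; rewrite -filter_from_ballE => -[r /= r0 rK].
pose u x := Num.max 0 (1 - r^-1 * mdist x0 x).
have cu : continuous u.
  move=> x; apply: (@continuous_max _ _ (cst 0) (fun x => 1 - r^-1 * mdist x0 x)).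
    exact: cvg_cst.
  apply: cvgB; first exact: cvg_cst.
  by apply: cvgM; [exact: cvg_cst|exact: mdist_continuous].
have u01 x : 0 <= u x <= 1.
  rewrite /u le_max lexx/= ge_max ler01/= lerBlDr lerDl mulr_ge0 ?mdist_ge0//.
  by rewrite invr_ge0 ltW.
exists u; split=> //; first by rewrite /u mdistxx mulr0 subr0 max_r.
move=> f cf; split.
  by apply: (CbM cf (Cb_real (M := 1) cu _)).1 => x; rewrite ger0_norm; case/andP: (u01 x).
move=> e e0; exists K => // x Kx.
suff -> : u x = 0 by rewrite mulr0 Normc.normc0.
rewrite /u max_l// subr_le0 ler_pdivlMl// mulr1 leNgt; apply/negP => xr.
by apply/Kx/rK; rewrite ballEmdist.
Qed.

End VanishingAtInfinity.

Section Semigroup.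
Context (R : realType) (E : pointedMetricType R).
Local Notation M := (complex_measure (borel E) R).
Local Notation bmeasE := (@bmeas _ (borel E) R).
Local Notation Int := (@integral_complex_measure _ (borel E) R).
Implicit Types (f g h : E -> R[i]) (x y : E) (t s : R).

Hypothesis E_locally_compact : locally_compact [set: E].
Variables (T : R -> (E -> R[i]) -> E -> R[i])
  (p : R -> E -> subprobability (borel E) R).
Hypotheses (T_feller : feller_semigroup T) (T_kernel : transition_kernel T p)
  (T_strong_feller : strong_feller p).
Variables (op : M -> M -> M) (a : E).
Hypotheses (op_bilinear : bilinear_op op) (opA : associative op)
  (opC : commutative op) (op1 : left_id (delta a) op)
  (op_continuous : weakly_continuous_op op)
  (op_probability : preserves_probability op).
Variable gamma : R -> probability (borel E) R.
Local Notation mu t := (of_finite_measure (gamma t)).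
Hypothesis gammaD : forall s t, 0 <= s -> 0 <= t -> mu (t + s) = op (mu t) (mu s).
Hypothesis pE : forall t x, 0 <= t ->
  of_finite_measure (p t x) = op (mu t) (delta x).

Lemma kernel_opE t f x : 0 <= t -> bmeasE f ->
  kernel_op p t f x = translate op (mu t) f x.
Proof.
by move=> t0 bf; rewrite /kernel_op -Int_of_finite// pE// opC.
Qed.

Lemma translate_delta (nu : M) f : translate op nu f a = Int nu f.
Proof. by rewrite /translate op1. Qed.

(** Strong continuity of the semigroup on [C0] makes [gamma t] converge weakly
    to the unit mass at [a]; no mass escapes since each [gamma t] is a
    probability. *)
Lemma gamma_cvg f : Cb f -> Int (mu t) f @[t --> 0^'+] --> f a.
Proof.
have gC0 g : C0 g -> Int (mu t) g @[t --> 0^'+] --> g a.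
  move=> g0; apply/cvg_normcP => e e0.
  have /cvgrPdist_lt/(_ _ e0) := feller_cvg T_feller g0.
  apply: filter_app; near=> t; rewrite sub0r normrN => H.
  have t0 : 0 <= t by [].
  have -> : Int (mu t) g - g a = (T t g - g) a.
    rewrite fctE/= T_kernel// kernel_opE ?translate_delta//.
    exact/Cb_bmeas/C0_Cb.
  apply: le_lt_trans H; apply: le_trans (ler_norm _).
  apply/normc_le_sup_norm/C0_Cb/C0_sub => //.
  exact: feller_C0 T_feller _ _ t0 g0.
move=> cf; have [u [cu ua u01 uC0]] := C0_cutoff a E_locally_compact.
have [_ [N fN]] := cf.
have u1 x : `|u x| <= 1 by rewrite ger0_norm; case/andP: (u01 x).
have cuC : Cb (fun x => (u x)%:C) := Cb_real cu u1.
have c1 : Int (mu t) (fun x => f x * (u x)%:C) @[t --> 0^'+] --> f a.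
  by have := gC0 _ (uC0 _ cf); rewrite ua mulr1.
have c2 : Int (mu t) (fun x => (u x)%:C) @[t --> 0^'+] --> (1 : R[i]).
  have := gC0 _ (uC0 _ (Cb_cst _ 1)); rewrite ua mulr1.
  by under [in X in X -> _]eq_fun do (under eq_fun do rewrite mul1r).
apply/cvg_normcP => e e0.
have N0 : 0 < N + 1.
  by rewrite ltr_wpDl// (le_trans _ (fN point))// normc_ge0.
have e2 : 0 < e / 2 by rewrite divr_gt0.
have e3 : 0 < e / 2 / (N + 1) by rewrite divr_gt0.
have /cvg_normcP/(_ _ e2) := c1; apply: filter_app.
have /cvg_normcP/(_ _ e3) := c2; apply: filter_app.
near=> t => h2 h1.
have bf := Cb_bmeas cf; have bu := Cb_bmeas cuC; have bfu := Cb_bmeas (CbM cf cuC).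
have -> : Int (mu t) f - f a = (Int (mu t) (fun x => f x * (u x)%:C) - f a) +
    Int (mu t) (fun x => f x - f x * (u x)%:C).
  by rewrite IntB// [RHS]addrC addrA subrK.
rewrite [e]splitr (le_lt_trans (ler_normcD _ _))// ltrD//.
have b3 : bmeasE (fun x => f x - f x * (u x)%:C) := bmeasB bf bfu.
(* dominate [f (1 - u)] by [(N + 1) (1 - u)], whose integral is known *)
have mv : measurable_fun setT ((fun x => (N + 1) * (1 - u x)) : borel E -> R).
  apply: continuous_borel => x; apply: cvgM; first exact: cvg_cst.
  by apply: cvgB; [exact: cvg_cst|exact: cu].
have v01 x : `|(N + 1) * (1 - u x)| <= N + 1.
  have /andP[u0 u1'] := u01 x.
  rewrite normrM (gtr0_norm N0) ger0_norm ?subr_ge0// ler_piMr ?(ltW N0)//.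
  by rewrite lerBlDr lerDl.
apply: le_lt_trans (normc_Int (gamma t) b3 mv v01 _) _.
  move=> x; have /andP[u0 u1'] := u01 x.
  have -> : f x - f x * (u x)%:C = f x * (1 - u x)%:C by rewrite rmorphB mulrBr mulr1.
  rewrite Normc.normcM normc_real (ger0_norm (_ : 0 <= 1 - u x)) ?subr_ge0//.
  by rewrite ler_wpM2r ?subr_ge0// (le_trans (fN x))// lerDl.
have iu : (gamma t).-integrable setT (EFin \o (u : borel E -> R)).
  exact: (bounded_integrable (gamma t) (continuous_borel cu) u1).
have i1 : (gamma t).-integrable setT (EFin \o (fun=> 1 : R)).
  by apply: (bounded_integrable (gamma t) (M := 1)) => // x; rewrite normr1.
have ReE : Re (Int (mu t) (fun x => (u x)%:C)) = \int[gamma t]_(x in setT) u x.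
  by rewrite Int_of_finite.
rewrite RintegralZl//; last first.
  apply: (bounded_integrable (gamma t) (M := 1)) => [|x].
    by apply: continuous_borel => x; apply: cvgB; [exact: cvg_cst|exact: cu].
  by have /andP[u0 u1'] := u01 x; rewrite ger0_norm ?subr_ge0// lerBlDr lerDl.
rewrite (RintegralB (f1 := fun=> 1) _ i1 iu)// Rintegral_cst// fine_probability_setT mulr1 -ReE.
rewrite mulrC -ltr_pdivlMr//.
apply: le_lt_trans h2; apply: le_trans (Re_le_normc _).
by move: (Int _ _) => z; rewrite Re_add Re_opp /= -normrN opprB; exact: ler_norm.
Unshelve. all: by end_near. Qed.

(** As [t] tends to 0, [gamma t] tends weakly to the unit mass at [a], so the
    matrix of [gamma t] stays nonsingular for small [t]; larger times are
    reached because [gamma t] is a power of [gamma (t / k)]. *)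
Lemma gamma_weakly_invertible f t : Cb f -> 0 < t ->
  weakly_invertible op (fun m : M => Int m f) (mu t).
Proof.
move=> cf t0; have bf := Cb_bmeas cf.
have [fs [cfs ker]] := op_finite_rank op_bilinear op_continuous cf.
have lL : linear_form (fun m : M => Int m f) by move=> c u v; rewrite Int_linear.
have l_ker u : (forall g, g \in fs -> weak_form g u = 0) ->
    forall v, Int (op u v) f = 0 by exact: ker.
have opl (c : R[i]) (u v w : M) : op (c *: u + v) w = c *: op u w + op v w.
  by rewrite op_bilinear.1.
have opr (c : R[i]) (u v w : M) : op w (c *: u + v) = c *: op w u + op w v.
  by rewrite op_bilinear.2.
have [n [x [y [d0 dinv]]]] :=
  @weakly_invertible_minor _ M op (delta a) opl opr opC op1 _ lL _ _ fs
    (@weak_form_linear R E) l_ker.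
have cvgd : \det (form_mx op (fun m : M => Int m f) (mu s) x y) @[s --> 0^'+] -->
    \det (form_mx op (fun m : M => Int m f) (delta a) x y).
  apply: cvg_det => i j; rewrite mxE.
  have E1 (m : M) : Int (op (x i) (op m (y j))) f =
      Int m (translate op (op (x i) (y j)) f).
    rewrite -(translate_Cb op_bilinear op_continuous _ cf).2.
    by rewrite opA (opC (x i)) -opA.
  rewrite E1 Int_delta; last first.
    exact/Cb_bmeas/(translate_Cb op_bilinear op_continuous _ cf).1.
  under eq_fun do rewrite mxE E1.
  exact/gamma_cvg/(translate_Cb op_bilinear op_continuous _ cf).1.
have small : \forall s \near 0^'+, weakly_invertible op (fun m : M => Int m f) (mu s).
  have : 0 < `|\det (form_mx op (fun m : M => Int m f) (delta a) x y)| by rewrite normr_gt0.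
  move/cvgrPdist_lt : cvgd => /[apply]; apply: filterS => s ds; apply: dinv.
  by apply: contraTneq ds => ->; rewrite subr0 ltxx.
have [e /= e0 eP] := small.
have [k kt] : exists k : nat, t / k.+1%:R < e.
  exists (Num.truncn (t / e)); rewrite ltr_pdivrMr// -ltr_pdivrMl// mulrC.
  by have /andP[_] := truncn_itv (ltW (divr_gt0 t0 e0)).
pose s := t / k.+1%:R; have s0 : 0 < s by rewrite divr_gt0.
have ws : weakly_invertible op (fun m : M => Int m f) (mu s).
  by apply: eP => //=; rewrite sub0r normrN gtr0_norm.
have wks (j : nat) : weakly_invertible op (fun m : M => Int m f) (mu (j.+1%:R * s)).
  elim: j => [|j IH]; first by rewrite mul1r.
  rewrite -natr1 mulrDl mul1r gammaD ?(ltW s0)//; last by rewrite mulr_ge0 ?(ltW s0).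
  exact: weakly_invertibleM.
by have := wks k; rewrite /s mulrC divfK// pnatr_eq0.
Qed.

(** A weak inverse [k] of [gamma t] for [f] yields the preimage
    [translate k f]; together with [semigroup_inj] this makes each operator
    of the semigroup a bijection of [Cb]. *)
Lemma semigroup_surj f t : Cb f -> 0 < t ->
  exists2 g, Cb g & translate op (mu t) g = f.
Proof.
move=> cf t0; have [k kE] := gamma_weakly_invertible cf t0.
have [ck Tk] := translate_Cb op_bilinear op_continuous k cf.
exists (translate op k f) => //; apply/funext => x.
by rewrite {1}/translate -Tk -opA kE Int_delta//; exact: Cb_bmeas.
Qed.

Lemma semigroup_inj f t : Cb f -> 0 < t ->
  translate op (mu t) f = cst 0 -> f = cst 0.
Proof.
move=> cf t0 Tf0; have [k kE] := gamma_weakly_invertible cf t0.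
apply/funext => x; rewrite -(Int_delta x (Cb_bmeas cf)) -kE.
rewrite (opC (mu t)) opA (translate_Cb op_bilinear op_continuous _ cf).2.
by rewrite Tf0 Int0.
Qed.

Lemma semigroup_comp t s f : 0 <= t -> 0 <= s -> bmeasE f ->
  translate op (mu (t + s)) f = translate op (mu t) (translate op (mu s) f).
Proof.
move=> t0 s0 bf; apply/funext => x; rewrite {1}/translate gammaD// opA.
by rewrite (translate_bmeas op_bilinear op_continuous op_probability _ bf).2.
Qed.

Lemma semigroup_Cb t f : 0 < t -> Bb f -> Cb (translate op (mu t) f).
Proof.
move=> t0 bf; rewrite (_ : translate _ _ _ = kernel_op p t f).
  exact: T_strong_feller.
by apply/funext => x; rewrite kernel_opE ?(ltW t0)//; exact: Bb_bmeas.
Qed.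

(** By the strong Feller property [T_1 h] is in [Cb], hence equals [T_1 g] for
    some [g] in [Cb]; for [0 < t < 1] the function [T_t h - T_t g] of [Cb] is
    sent to 0 by [T_(1 - t)], hence is 0. The limit is thus that of the integrals
    of [g]. *)
Lemma gamma_Bb_cvg h : Bb h -> cvg (Int (mu t) h @[t --> 0^'+]).
Proof.
move=> bh; have [g cg gE] := semigroup_surj (semigroup_Cb ltr01 bh) ltr01.
have bg := Cb_bmeas cg; have bmh := Bb_bmeas bh.
apply/cvg_ex; exists (g a).
apply: cvg_trans (gamma_cvg cg); apply: near_eq_cvg; near=> t.
have t0 : 0 < t by [].
have t1 : 0 < 1 - t by rewrite subr_gt0; near: t; exact: nbhs_right_lt.
pose u x := -1 * translate op (mu t) h x + translate op (mu t) g x.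
have ch := semigroup_Cb t0 bh.
have cTg := (translate_Cb op_bilinear op_continuous (mu t) cg).1.
have cu : Cb u by exact: Cb_lin.
have Tu : translate op (mu (1 - t)) u = cst 0.
  apply/funext => x; rewrite /translate (daniell_Int _).1//; [|exact: Cb_bmeas..].
  rewrite -!/(translate op (mu (1 - t)) _ x) -!semigroup_comp ?(ltW t1) ?(ltW t0)//.
  by rewrite subrK gE mulN1r addNr.
have /(congr1 (fun v => v a)) := semigroup_inj cu t1 Tu.
by rewrite /u !translate_delta mulN1r addrC => /eqP; rewrite subr_eq0 => /eqP.
Unshelve. all: by end_near. Qed.

End Semigroup.

(** * Setwise convergence and a gliding hump *)

Lemma truncn_inv_lt (R : realType) (e : R) : 0 < e ->
  (Num.truncn e^-1).+1%:R^-1 < e.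
Proof.
move=> e0; rewrite invf_plt ?posrE//.
by have /andP[] := truncn_itv (ltW (etrans (invr_gt0 e) e0)).
Qed.

Section GlidingHump.
Context d (X : measurableType d) (R : realType).
Variables (Q : R -> probability X R) (D : X -> R).
Hypothesis mD : measurable_fun setT D.

Local Notation q t A := (fine ((Q t : {measure set X -> \bar R}) A)).

Let qU t A B : measurable A -> measurable B -> A `&` B = set0 ->
  q t (A `|` B) = q t A + q t B.
Proof.
by move=> mA mB AB; rewrite measureU// fineD// fin_num_measure.
Qed.

Let q_le t A B : measurable A -> measurable B -> A `<=` B -> q t A <= q t B.
Proof.
by move=> mA mB AB; rewrite fine_le ?fin_num_measure// le_measure ?inE.
Qed.

Let qT t : q t setT = 1.
Proof. exact: (congr1 fine (probability_setT (Q t))). Qed.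

Let mlt r : measurable [set x | D x < r].
Proof. by rewrite -[X in measurable X]setTI; exact: measurable_fun_ltr. Qed.

Let mge r : measurable [set x | r <= D x].
Proof. by rewrite -[X in measurable X]setTI; exact: measurable_fun_ler. Qed.

Let mgt r : measurable [set x | r < D x].
Proof. by rewrite -[X in measurable X]setTI; exact: measurable_fun_ltr. Qed.

(** The shells [0 < D < r'] decrease to the empty set. *)
Let gap t r e : 0 < r -> 0 < e -> exists2 r', 0 < r' < r &
  q t [set x | 0 < D x < r'] < e.
Proof.
move=> r0 e0; pose B n := [set x | 0 < D x < n.+1%:R^-1].
have mB n : measurable (B n).
  rewrite (_ : B n = [set x | 0 < D x] `&` [set x | D x < n.+1%:R^-1]).
    exact: measurableI.
  by apply/seteqP; split=> x /=; [move=> /andP[? ?]; split|move=> [? ?]; apply/andP].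
have B0 : \bigcap_n B n = set0.
  rewrite -subset0 => x Bx; have /andP[Dx _] := Bx 0%N I.
  have /andP[_] := Bx (Num.truncn (D x)^-1) I.
  by move/lt_trans/(_ (truncn_inv_lt Dx)); rewrite ltxx.
have : (Q t : {measure set X -> \bar R}) (B n) @[n --> \oo] --> 0%E.
  rewrite -(measure0 (Q t)) -B0; apply: nonincreasing_cvg_mu => //.
  - by rewrite ltey_eq fin_num_measure.
  - exact: bigcapT_measurable.
  - apply/nonincreasing_seqP => n; rewrite subsetEset => x /= /andP[Dx DxS].
    apply/andP; split=> //; apply: (lt_le_trans DxS).
    by rewrite lef_pV2 ?posrE// ler_nat.
move=> /fine_cvg/cvgrPdist_lt/(_ _ e0) [N1 _ N1P].
pose n := maxn N1 (Num.truncn r^-1).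
exists n.+1%:R^-1.
  rewrite invr_gt0 ltr0n/=; apply: le_lt_trans (truncn_inv_lt r0).
  by rewrite lef_pV2 ?posrE// ler_nat ltnS leq_maxr.
have := N1P n (leq_maxl _ _); rewrite /= sub0r normrN.
exact: le_lt_trans (ler_norm _).
Qed.

(** Otherwise the zero set has mass at most 1/2 at all times, and one can choose
    times [tau k] tending to 0 and disjoint shells [r (k+1) <= D < r k] such that
    [Q (tau k)] is carried by the zero set and the [k]-th shell up to an error
    1/8. The union of the even shells then has measure at least 3/8 at even [k]
    and at most 1/8 at odd [k], so that its measure has no limit. *)
Lemma concentration_charges_zero_set :
  (forall r, 0 < r -> q t [set x | r <= D x] @[t --> 0^'+] --> 0) ->
  (forall A, measurable A -> cvg (q t A @[t --> 0^'+])) ->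
  exists2 t, 0 < t & 1 / 2 < q t [set x | D x <= 0].
Proof.
move=> Qfar Qcvg; apply: contrapT => none.
have mle : measurable [set x | D x <= 0].
  by rewrite -[X in measurable X]setTI; exact: measurable_fun_ler.
have Qzero t : 0 < t -> q t [set x | D x <= 0] <= 1 / 2.
  by move=> t0; rewrite leNgt; apply/negP => h; apply: none; exists t.
(* The two errors of 1/16 add up to 1/8; together with the mass at most 1/2 of
   the zero set they leave at least 3/8 for the shell. *)
have next (kr : nat * R) : exists tr : R * R, 0 < kr.2 ->
    [/\ 0 < tr.1 < kr.1.+1%:R^-1, 0 < tr.2 < kr.2,
        q tr.1 [set x | kr.2 <= D x] < 1 / 16 &
        q tr.1 [set x | 0 < D x < tr.2] < 1 / 16].
  case: kr => k r; have [r0|] := ltP 0 r; last by exists (0, 0).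
  have e0 : 0 < 1 / 16 :> R by rewrite divr_gt0.
  have /cvgrPdist_lt/(_ _ e0)[e /= e1 eP] := Qfar r r0.
  pose t := Num.min (e / 2) (k.+1%:R^-1 / 2).
  have t0 : 0 < t by rewrite lt_min !divr_gt0// invr_gt0.
  have te : t < e by rewrite gt_min ltr_pdivrMr// ltr_pMr// ltr1n.
  have tk : t < k.+1%:R^-1.
    by rewrite gt_min [X in _ || X]ltr_pdivrMr// ltr_pMr ?invr_gt0// ltr1n orbT.
  have [r' r'r qr'] := gap t r0 e0.
  exists (t, r') => _; split=> //=; first by rewrite t0.
  have := eP t; rewrite /= sub0r normrN gtr0_norm// => /(_ te t0).
  by rewrite sub0r normrN; exact: le_lt_trans (ler_norm _).
have [F FP] := choice next.
pose r := fix r k := if k is k'.+1 then (F (k', r k')).2 else 1 : R.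
pose tau k := (F (k, r k)).1.
have r0 k : 0 < r k.
  by elim: k => [//|k /= IH]; have [_ /andP[]] := FP (k, r k) IH.
have rS k : r k.+1 < r k by have [_ /andP[]] := FP (k, r k) (r0 k).
have r_le j k : (j <= k)%N -> r k <= r j.
  move=> jk; apply: (@nonincreasing_seqP _ _ r).1 => // n; exact: ltW.
have tau0 k : 0 < tau k < k.+1%:R^-1 by have [] := FP (k, r k) (r0 k).
have far k : q (tau k) [set x | r k <= D x] < 1 / 16 by have [] := FP (k, r k) (r0 k).
have close k : q (tau k) [set x | 0 < D x < r k.+1] < 1 / 16.
  by have [] := FP (k, r k) (r0 k).
pose A k := [set x | r k.+1 <= D x] `&` [set x | D x < r k].
have mA k : measurable (A k) by exact: measurableI.
pose H := \bigcup_k A (2 * k)%N.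
have mH : measurable H by exact: bigcupT_measurable.
have mcl k : measurable [set x | 0 < D x < r k].
  rewrite (_ : [set x | 0 < D x < r k] = [set x | 0 < D x] `&` [set x | D x < r k]).
    exact: measurableI.
  by apply/seteqP; split=> x /=; [move=> /andP[? ?]; split|move=> [? ?]; apply/andP].
have mrest k : measurable ([set x | r k <= D x] `|` [set x | 0 < D x < r k.+1]).
  exact: measurableU.
have rest k : q (tau k) ([set x | r k <= D x] `|` [set x | 0 < D x < r k.+1]) < 1 / 8.
  rewrite qU//; last first.
    rewrite -subset0 => x /= [rD /andP[_ /lt_le_trans/(_ (ltW (rS k)))]].
    by rewrite ltNge rD.
  by rewrite (lt_le_trans (ltrD (far k) (close k)))//; lra.
have Heven k : 3 / 8 <= q (tau (2 * k)%N) H.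
  have /andP[t0 _] := tau0 (2 * k)%N.
  have AH : A (2 * k)%N `<=` H by move=> x Ax; exists k.
  apply: le_trans (q_le _ (mA _) mH AH).
  have cover : [set: X] = A (2 * k)%N `|`
      (([set x | r (2 * k)%N <= D x] `|` [set x | 0 < D x < r (2 * k).+1]) `|`
       [set x | D x <= 0]).
    apply/esym/seteqP; split=> // x _.
    have [Dr|Dr] := leP (r (2 * k)%N) (D x); first by right; left; left.
    have [Dr'|Dr'] := leP (r (2 * k).+1) (D x); first by left.
    have [Dz|Dz] := leP (D x) 0; first by right; right.
    by right; left; right; rewrite /= Dz.
  have := qT (tau (2 * k)%N); rewrite cover qU//; last 2 first.
  - by apply: measurableU.
  - rewrite -subset0 => x /= [[rD Dr] [[]|]].
    + by rewrite leNgt Dr.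
    + by move=> /andP[_]; rewrite ltNge rD.
    + by move=> /(le_trans rD); rewrite leNgt r0.
  rewrite qU//; last first.
    rewrite -subset0 => x /= [[rD|/andP[Dx _]] Dz].
      by have := lt_le_trans (r0 (2 * k)%N) (le_trans rD Dz); rewrite ltxx.
    by move: Dz; rewrite leNgt Dx.
  have := rest (2 * k)%N; have := Qzero _ t0; lra.
have Hodd k : q (tau (2 * k).+1%N) H <= 1 / 8.
  apply: le_trans (ltW (rest (2 * k).+1)); apply: q_le => // x [j _ [rD Dr]].
  have [jk|kj] := leqP j k.
    by left; apply: le_trans rD; apply: (r_le (2 * j).+1); rewrite ltnS leq_mul2l jk.
  right; apply/andP; split; first exact: lt_le_trans (r0 _) rD.
  by apply: lt_le_trans Dr _; apply: r_le; lia.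
have /cvg_ex[l /= lP] := Qcvg H mH.
have e0 : 0 < 1 / 16 :> R by rewrite divr_gt0.
have /cvgrPdist_lt/(_ _ e0)[e /= e1 eP] := lP.
pose k := Num.truncn e^-1.
have small j : (k <= j)%N -> `|l - q (tau j) H| < 1 / 16.
  move=> kj; have /andP[t0 tj] := tau0 j.
  apply: eP => //=; rewrite sub0r normrN gtr0_norm// (lt_le_trans tj)//.
  apply: le_trans (ltW (truncn_inv_lt e1)).
  by rewrite lef_pV2 ?posrE// ler_nat ltnS.
have k2 : (k <= 2 * k)%N by rewrite leq_pmull.
have := small _ k2; have := small _ (leqW k2); have := Heven k; have := Hodd k.
rewrite !ltr_norml => ? ? /andP[? ?] /andP[? ?]; lra.
Qed.

End GlidingHump.

(** * Laplace transforms of multiplicative functions *)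

Section LebesgueFacts.
Context (R : realType).
Local Notation mu := (@lebesgue_measure R).
Implicit Types (f : R -> R).

Lemma Rintegral_shift f s : continuous f ->
  \int[mu]_(t in `[0, +oo[) f (t + s) = \int[mu]_(t in `[s, +oo[) f t.
Proof.
move=> cf.
have shift_ge0 (g : R -> R) : continuous g -> (forall t, 0 <= g t) ->
    (\int[mu]_(t in `[s, +oo[) (g t)%:E = \int[mu]_(t in `[0%R, +oo[) (g (t + s)%R)%:E)%E.
  move=> cg g0; pose F t := t + s.
  have dF (t : R) : is_derive t (1 : R) F (1 : R) := is_derive_shift t 1 s.
  have F'E : (F^`())%classic = cst 1.
    by apply/funext => t; rewrite derive1E derive_val.
  have F0 : F 0 = s by rewrite /F add0r.
  have cF : continuous F by move=> t; apply: cvgD; [exact: cvg_id|exact: cvg_cst].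
  rewrite -{1}F0 (@increasing_ge0_integration_by_substitutiony R F g 0).
  - by apply: eq_integral => t _; rewrite F'E /= mulr1.
  - by move=> x y _ _; rewrite /F ltrD2r.
  - by rewrite F'E => x _; exact: cvg_cst.
  - by rewrite F'E; exact: is_cvg_cst.
  - by rewrite F'E; exact: is_cvg_cst.
  - split; first by move=> x _; exact: ex_derive.
    by apply: cvg_at_right_filter; exact: cF.
  - by apply: cvg_addrr; exact: cvg_id.
  - exact: continuous_subspaceT.
  - by [].
have posE (u : R -> R) t : ((fun t => (u t)%:E)^\+ t = (Num.max (u t) 0)%:E)%E.
  by rewrite funeposE EFin_max.
have negE (u : R -> R) t : ((fun t => (u t)%:E)^\- t = (Num.max (- u t) 0)%:E)%E.
  by rewrite funenegE EFin_max EFinN.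
have cmax (u : R -> R) : continuous u -> continuous (fun t => Num.max (u t) 0).
  move=> cu t; apply: (@continuous_max _ _ u (cst 0)); first exact: cu.
  exact: cvg_cst.
have max0 (x : R) : 0 <= Num.max x 0 by rewrite le_max lexx orbT.
rewrite /Rintegral integralE [in RHS]integralE; congr (fine (_ - _)).
- transitivity (\int[mu]_(t in `[0%R, +oo[) (Num.max (f (t + s)) 0)%:E)%E.
    by apply: eq_integral => t _; exact: (posE (fun t => f (t + s))).
  rewrite -(shift_ge0 _ (cmax _ cf))//; apply: eq_integral => t _.
  exact/esym/posE.
- transitivity (\int[mu]_(t in `[0%R, +oo[) (Num.max (- f (t + s)) 0)%:E)%E.
    by apply: eq_integral => t _; exact: (negE (fun t => f (t + s))).
  have cN : continuous (fun t => - f t) by move=> t; apply: cvgN; exact: cf.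
  rewrite -(shift_ge0 _ (cmax _ cN))//; apply: eq_integral => t _.
  exact/esym/negE.
Qed.

Lemma exp_dominated_integrable f (eta : R) : 0 < eta -> continuous f ->
  (forall t, 0 <= t -> `|f t| <= expR (- (eta * t))) ->
  mu.-integrable `[0, +oo[ (EFin \o f).
Proof.
move=> eta0 cf fle.
have i1 : mu.-integrable `[0, +oo[ (EFin \o exponential_pdf eta).
  by apply: integrableS (integrable_exponential_pdf eta0).
have i2 : mu.-integrable `[0, +oo[ (fun t => (eta^-1)%:E * (exponential_pdf eta t)%:E)%E.
  exact: integrableZl.
apply: le_integrable i2 => //.
  by apply/measurable_EFinP; apply: measurable_funTS; exact: continuous_measurable_fun.
move=> t; rewrite /= in_itv/= andbT => t0.
rewrite lee_fin exponential_pdfE// normrM (gtr0_norm (_ : 0 < eta^-1)) ?invr_gt0//.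
rewrite normrM (gtr0_norm eta0) mulKf ?gt_eqF// ger0_norm ?expR_ge0//.
by rewrite mulNr fle.
Qed.

Lemma Rintegral_avg f : continuous f ->
  s^-1 * \int[mu]_(t in `[0, s]) f t @[s --> 0^'+] --> f 0.
Proof.
move=> cf; apply/cvgrPdist_le => e e0.
have /cvgrPdist_le/(_ _ e0) := cf 0; rewrite -filter_from_ballE => -[d /= d0 dP].
near=> s.
have s0 : 0 < s by [].
have sd : s < d by near: s; exact: nbhs_right_lt.
have ci g : continuous g -> mu.-integrable `[0, s] (EFin \o g).
  move=> cg; apply: continuous_compact_integrable; first exact: segment_compact.
  exact: continuous_subspaceT.
have is_ := ci _ cf.
have cc (c : R) : continuous (fun _ : R => c) by move=> x; exact: cvg_cst.
have mus : fine (mu `[0, s]) = s.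
  by rewrite lebesgue_measure_itv/= lte_fin s0/= oppr0 addr0.
have cd : continuous (fun t => f 0 - f t).
  by move=> x; apply: cvgB; [exact: cvg_cst|exact: cf].
have -> : f 0 - s^-1 * \int[mu]_(t in `[0, s]) f t =
    s^-1 * \int[mu]_(t in `[0, s]) (f 0 - f t).
  rewrite (RintegralB (f1 := fun=> f 0))//; last exact: ci.
  by rewrite Rintegral_cst// mus mulrBr mulrCA mulVf ?gt_eqF// mulr1.
rewrite normrM gtr0_norm ?invr_gt0// ler_pdivrMl//.
apply: le_trans (le_normr_Rintegral _ (ci _ cd)) _ => //.
have -> : s * e = \int[mu]_(t in `[0, s]) e by rewrite Rintegral_cst// mus mulrC.
apply: le_Rintegral => //.
- exact/integrable_norm/ci.
- exact: ci.
move=> t; rewrite /= in_itv/= => /andP[t0 ts].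
apply: dP; rewrite /ball/= sub0r normrN ger0_norm//.
exact: le_lt_trans ts sd.
Unshelve. all: by end_near. Qed.

(** Both bounds come from [1 + x <= expR x], at [x = eta * s] and at
    [x = - (eta * s)]. *)
Lemma cvg_one_sub_exp (eta : R) : 0 < eta ->
  (1 - expR (- (eta * s))) / s @[s --> 0^'+] --> eta.
Proof.
move=> eta0; apply/cvgrPdist_le => e e0; near=> s.
have s0 : 0 < s by [].
have E1 : 1 - eta * s <= expR (- (eta * s)) by exact: expR_ge1Dx.
have E2 : 1 + eta * s <= expR (eta * s) by exact: expR_ge1Dx.
set x := expR (- (eta * s)) in E1 *.
have xE : x * expR (eta * s) = 1 by rewrite /x expRN mulVf// gt_eqF ?expR_gt0.
have x0 : 0 < x by exact: expR_gt0.
have x1 : x * (1 + eta * s) <= 1 by rewrite -[leRHS]xE ler_pM2l.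
have small : eta ^+ 2 * s <= e.
  rewrite -ler_pdivlMl ?exprn_gt0//.
  by near: s; apply: nbhs_right_le; rewrite mulr_gt0 ?invr_gt0 ?exprn_gt0.
have -> : eta - (1 - x) / s = (eta * s - (1 - x)) / s.
  by field; rewrite gt_eqF.
rewrite normrM normfV (gtr0_norm s0) ler_pdivrMr// ger0_norm; last lra.
apply: (@le_trans _ _ ((eta ^+ 2 * s) * s)); last by rewrite ler_pM2r.
set y := eta * s in E1 x1 *; have y0 : 0 < y by rewrite mulr_gt0.
have -> : eta ^+ 2 * s * s = y ^+ 2 by rewrite /y exprMn -mulrA.
suff : x <= 1 - y + y ^+ 2 by lra.
have y1 : 0 < 1 + y by rewrite ltr_wpDl.
rewrite -(ler_pM2r y1) (le_trans x1)//.
have -> : (1 - y + y ^+ 2) * (1 + y) = 1 + y ^+ 3 by ring.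
by rewrite lerDl exprn_ge0 ?ltW.
Unshelve. all: by end_near. Qed.


End LebesgueFacts.

Section MultiplicativeFunction.
Context (R : realType).
Local Notation mu := (@lebesgue_measure R).
Variable c : R -> R[i].
Hypothesis c_le1 : forall t : R, 0 <= t -> normc (c t) <= 1.
Hypothesis cD : forall s t : R, 0 <= s -> 0 <= t -> c (s + t) = c s * c t.
Hypothesis c_cvg : c t @[t --> 0^'+] --> (1 : R[i]).

(** Extending [c] evenly yields a function continuous on the whole line, which
    settles measurability and avoids one-sided continuity at 0. *)
Definition even_ext (t : R) := c `|t|.

Let even_ext_cont : continuous even_ext.
Proof.
move=> t; apply/cvg_normcP => e e0.
have /cvg_normcP/(_ _ e0) := c_cvg => -[d /= d0 dP].
have step u v : 0 <= u -> u < v -> v - u < d -> normc (c v - c u) < e.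
  move=> u0 uv vud; have vu0 : 0 < v - u by rewrite subr_gt0.
  have -> : c v - c u = c u * (c (v - u) - 1).
    have uE : u + (v - u) = v by rewrite addrC subrK.
    by rewrite mulrBr -cD ?(ltW vu0)// mulr1 uE.
  rewrite Normc.normcM; apply: le_lt_trans (ler_piMl (normc_ge0 _) (c_le1 u0)) _.
  by apply: dP => //=; rewrite sub0r normrN gtr0_norm.
have : nbhs t (ball t d) by exact: nbhsx_ballx.
apply: filterS => s; rewrite /ball/= => ts.
have tsd : `| `|t| - `|s| | < d by apply: le_lt_trans ts; exact: ler_dist_dist.
rewrite /even_ext; have [st|st|->] := ltgtP `|s| `|t|.
- rewrite -normc_opp opprB step// (le_lt_trans _ tsd)//; exact: ler_norm.
- rewrite step// (le_lt_trans _ tsd)// distrC; exact: ler_norm.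
- by rewrite subrr Normc.normc0.
Qed.

Let even_ext0 : even_ext 0 = 1.
Proof.
have h : even_ext t @[t --> 0^'+] --> even_ext 0.
  by apply: cvg_at_right_filter; exact: even_ext_cont.
apply: (@cvg_unique _ (@norm_hausdorff _ R[i]) _ _ _ _ h).
apply: cvg_trans c_cvg; apply: near_eq_cvg; near=> t.
by rewrite /even_ext ger0_norm.
Unshelve. all: by end_near. Qed.

Definition damped (eta t : R) : R[i] := (expR (- (eta * t)))%:C * even_ext t.

Let exp_cont (eta : R) : continuous (fun t => expR (- (eta * t))).
Proof.
move=> t; apply: continuous_comp; last exact: continuous_expR.
by apply: cvgN; apply: cvgM; [exact: cvg_cst|exact: cvg_id].
Qed.

Let damped_cont eta : continuous (damped eta).
Proof.
move=> t; apply: cvgM; last exact: even_ext_cont.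
exact: (@continuous_real_complex R _ _ (@exp_cont eta) t).
Qed.

Let damped_Re eta : continuous (fun t => Re (damped eta t)).
Proof. by move=> t; have /cvg_complexP[] := (@damped_cont eta) t. Qed.

Let damped_Im eta : continuous (fun t => Im (damped eta t)).
Proof. by move=> t; have /cvg_complexP[] := (@damped_cont eta) t. Qed.

Let damped_le eta t : 0 <= t -> normc (damped eta t) <= expR (- (eta * t)).
Proof.
move=> t0; rewrite Normc.normcM normc_real ger0_norm ?expR_ge0//.
by rewrite ler_piMr ?expR_ge0// c_le1.
Qed.

Let damped_add eta s t : 0 <= s -> 0 <= t ->
  damped eta (t + s) = damped eta s * damped eta t.
Proof.
move=> s0 t0; rewrite /damped /even_ext !ger0_norm ?addr_ge0// cD// mulrDr opprD expRD rmorphM/=.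
by ring.
Qed.

Definition laplace (eta : R) : R[i] :=
  complex_integral mu `[0, +oo[ (fun t => (expR (- (eta * t)))%:C * c t).

Let laplaceE eta : laplace eta = complex_integral mu `[0, +oo[ (damped eta).
Proof.
have E t : t \in `[0, +oo[%classic -> (expR (- (eta * t)))%:C * c t = damped eta t.
  by rewrite inE/= in_itv/= andbT => t0; rewrite /damped /even_ext ger0_norm.
rewrite /laplace /complex_integral; congr (_ +i* _);
  by apply: eq_Rintegral => t tI; rewrite E.
Qed.

Let damped_intRe eta : 0 < eta ->
  mu.-integrable `[0, +oo[ (EFin \o (fun t => Re (damped eta t))).
Proof.
move=> eta0; apply: (exp_dominated_integrable eta0); first exact: damped_Re.
by move=> t t0; apply: le_trans (Re_le_normc _) (damped_le eta t0).
Qed.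

Let damped_intIm eta : 0 < eta ->
  mu.-integrable `[0, +oo[ (EFin \o (fun t => Im (damped eta t))).
Proof.
move=> eta0; apply: (exp_dominated_integrable eta0); first exact: damped_Im.
by move=> t t0; apply: le_trans (Im_le_normc _) (damped_le eta t0).
Qed.

Let damped_scale eta z : 0 < eta ->
  complex_integral mu `[0, +oo[ (fun t => z * damped eta t) = z * laplace eta.
Proof.
move=> eta0; have iRe := damped_intRe eta0; have iIm := damped_intIm eta0.
have iZ (k : R) (u : R -> R) : mu.-integrable `[0, +oo[ (EFin \o u) ->
    mu.-integrable `[0, +oo[ (EFin \o (fun x => k * u x)).
  by move=> iu; have := @integrableZl _ _ _ mu _ (measurable_itv `[0, +oo[) k _ iu.
rewrite laplaceE /complex_integral.
under eq_Rintegral do rewrite Re_mul.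
under [X in _ +i* X]eq_Rintegral do rewrite Im_mul.
rewrite RintegralB//; [|exact: iZ..].
rewrite RintegralD//; [|exact: iZ..].
by rewrite !RintegralZl//; case: z.
Qed.

(** Splitting the integral at [s] and translating the tail back. *)
Let laplace_split eta s : 0 < eta -> 0 < s ->
  laplace eta * (1 - damped eta s) = complex_integral mu `[0, s] (damped eta).
Proof.
move=> eta0 s0.
have tail (f : R -> R) : continuous f -> mu.-integrable `[0, +oo[ (EFin \o f) ->
    \int[mu]_(t in `[0, s]) f t =
    \int[mu]_(t in `[0, +oo[) f t - \int[mu]_(t in `[0, +oo[) f (t + s).
  move=> cf If; rewrite Rintegral_shift//.
  have -> : \int[mu]_(t in `[s, +oo[) f t = \int[mu]_(t in `]s, +oo[) f t.
    apply/esym/Rintegral_itv_obnd_cbnd.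
    by apply: integrableS If => //; apply: subset_itvr; rewrite bnd_simp ltW.
  rewrite -(Rintegral_itvB If) ?bnd_simp ?(ltW s0)//.
  by rewrite opprB addrC subrK.
rewrite mulrBr mulr1 mulrC -damped_scale// laplaceE.
rewrite [RHS](_ : _ = complex_integral mu `[0, +oo[ (damped eta) -
    complex_integral mu `[0, +oo[ (fun t => damped eta (t + s))); last first.
  rewrite /complex_integral (tail _ (@damped_Re eta))//; last exact: damped_intRe.
  by rewrite (tail _ (@damped_Im eta))//; exact: damped_intIm.
congr (_ - _).
have E t : t \in `[0, +oo[%classic -> damped eta s * damped eta t = damped eta (t + s).
  by rewrite inE/= in_itv/= andbT => t0; rewrite damped_add// ltW.
by rewrite /complex_integral; congr (_ +i* _); apply: eq_Rintegral => t tI; rewrite E.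
Qed.

Let cvg_laplace eta : 0 < eta ->
  laplace eta * (s^-1%:C * (1 - damped eta s)) @[s --> 0^'+] --> (1 : R[i]).
Proof.
move=> eta0.
have lim : s^-1%:C * complex_integral mu `[0, s] (damped eta) @[s --> 0^'+] --> (1 : R[i]).
  have -> : (1 : R[i]) = damped eta 0 by rewrite /damped even_ext0 mulr0 oppr0 expR0 mulr1.
  apply/cvg_complexP; split.
    under eq_fun do rewrite Re_mul mul0r subr0.
    exact: Rintegral_avg (@damped_Re eta).
  under eq_fun do rewrite Im_mul mul0r addr0.
  exact: Rintegral_avg (@damped_Im eta).
apply: cvg_trans lim; apply: near_eq_cvg; near=> s.
by rewrite -laplace_split// mulrCA.
Unshelve. all: by end_near. Qed.

(** The limit of [cvg_laplace] solved for the difference quotient of [c]. As the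
    quotient does not involve [eta], neither does [(laplace eta)^-1 - eta]. *)
Let cvg_slope eta : 0 < eta -> laplace eta != 0 /\
  s^-1%:C * (1 - c s) @[s --> 0^'+] --> (laplace eta)^-1 - eta%:C.
Proof.
move=> eta0; have k0 : laplace eta != 0.
  apply/eqP => k0; have := cvg_laplace eta0; rewrite k0.
  under eq_fun do rewrite mul0r.
  move=> h; have : (1 : R[i]) = 0.
    by apply: (@cvg_unique _ (@norm_hausdorff _ R[i]) _ _ _ _ h); exact: cvg_cst.
  by apply/eqP; rewrite oner_eq0.
split; first exact: k0.
have h1 : s^-1%:C * (1 - damped eta s) @[s --> 0^'+] --> (laplace eta)^-1.
  have -> : (fun s => s^-1%:C * (1 - damped eta s)) =
      (fun s => (laplace eta)^-1 * (laplace eta * (s^-1%:C * (1 - damped eta s)))).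
    by apply/funext => s; rewrite mulKf.
  rewrite -[X in _ --> X]mulr1; apply: cvgM; first exact: cvg_cst.
  exact: cvg_laplace.
have h2 : ((1 - expR (- (eta * s))) / s)%:C @[s --> 0^'+] --> eta%:C.
  apply/cvg_complexP; split=> /=; last exact: cvg_cst.
  exact: cvg_one_sub_exp.
have h3 : (expR (eta * s))%:C @[s --> 0^'+] --> (1 : R[i]).
  apply/cvg_complexP; split=> /=; last exact: cvg_cst.
  rewrite -[X in _ --> X](@expR0 R) -[X in expR X](mulr0 eta).
  apply: cvg_at_right_filter; apply: continuous_comp; last exact: continuous_expR.
  by apply: cvgM; [exact: cvg_cst|exact: cvg_id].
have h4 : (expR (eta * s))%:C * (s^-1%:C * (1 - damped eta s) -
    ((1 - expR (- (eta * s))) / s)%:C) @[s --> 0^'+] --> (laplace eta)^-1 - eta%:C.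
  rewrite -[X in _ --> X]mul1r; apply: cvgM; first exact: h3.
  exact: (cvgB h1 h2).
apply: (cvg_trans _ h4).
apply: near_eq_cvg; near=> s.
have s0 : 0 < s by [].
have YX : (expR (eta * s))%:C * (expR (- (eta * s)))%:C = 1 :> R[i].
  by rewrite -rmorphM/= -expRD subrr expR0.
have -> : ((1 - expR (- (eta * s))) / s)%:C =
    s^-1%:C * (1 - (expR (- (eta * s)))%:C) :> R[i].
  by rewrite mulrC rmorphM rmorphB.
rewrite /= /damped /even_ext (ger0_norm (ltW s0)).
move: YX; move: (expR (eta * s))%:C (expR (- (eta * s)))%:C s^-1%:C (c s) => y x s' z YX.
by transitivity (y * x * (s' * (1 - z))); [ring|rewrite YX mul1r].
Unshelve. all: by end_near. Qed.

Lemma laplace_scale eta z : 0 < eta ->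
  complex_integral mu `[0, +oo[ (fun t => (expR (- (eta * t)))%:C * (z * c t)) =
  z * complex_integral mu `[0, +oo[ (fun t => (expR (- (eta * t)))%:C * c t).
Proof.
move=> eta0; rewrite -/(laplace eta) -damped_scale//.
have E t : t \in `[0, +oo[%classic ->
    (expR (- (eta * t)))%:C * (z * c t) = z * damped eta t.
  by rewrite inE/= in_itv/= andbT => t0; rewrite mulrCA /damped /even_ext ger0_norm.
by rewrite /complex_integral; congr (_ +i* _); apply: eq_Rintegral => t tI; rewrite E.
Qed.

(** The number [- lambda] is the right derivative of [c] at 0, which exists by
    [cvg_slope]; its real part is nonpositive because [c] is bounded by 1. *)
Lemma laplace_multiplicative : exists2 lambda : R[i], 0 <= Re lambda &
  forall eta : R, 0 < eta ->
    (eta%:C + lambda) *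
    complex_integral mu `[0, +oo[ (fun t => (expR (- (eta * t)))%:C * c t) = 1.
Proof.
have [_ h1] := cvg_slope ltr01.
exists ((laplace 1)^-1 - 1%:C).
  have /cvg_complexP[hr _] := h1.
  apply: (cvgr_to_ge hr); near=> s.
  have s0 : 0 < s by [].
  rewrite Re_mul mul0r subr0 mulr_ge0// ?invr_ge0 ?(ltW s0)// Re_add Re_opp subr_ge0.
  by apply: le_trans (ler_norm _) _; apply: le_trans (Re_le_normc _) (c_le1 (ltW s0)).
move=> eta eta0; have [k0 h] := cvg_slope eta0.
rewrite (@cvg_unique _ (@norm_hausdorff _ R[i]) _ _ _ _ h1 h).
by rewrite -/(laplace eta) addrC subrK mulVf.
Unshelve. all: by end_near. Qed.

End MultiplicativeFunction.

(** * Multiplicative functions of the convolution *)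

Section Character.
Context (R : realType) (E : pointedMetricType R).
Local Notation M := (complex_measure (borel E) R).
Local Notation bmeasE := (@bmeas _ (borel E) R).
Local Notation Int := (@integral_complex_measure _ (borel E) R).
Implicit Types (f g h : E -> R[i]) (x y : E) (t s : R).

Lemma fine_measureE (P : probability (borel E) R) (A : set (borel E)) :
  measurable A ->
  fine ((P : {measure set (borel E) -> \bar R}) A) = Re (Int (of_finite_measure P) (cindic A)).
Proof.
move=> mA; rewrite Int_of_finite; last exact: bmeas_indic.
by rewrite (complex_integral_indic (P : {finite_measure set (borel E) -> \bar R})).
Qed.

Lemma Re_Int_real (P : probability (borel E) R) (u : E -> R) (N : R) :
  measurable_fun setT (u : borel E -> R) -> (forall x, `|u x| <= N) ->
  Re (Int (of_finite_measure P) (fun x => (u x)%:C)) = \int[P]_(x in setT) u x.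
Proof.
move=> mu uN; rewrite Int_of_finite//; split => //.
by exists N => x; rewrite normc_real.
Qed.

Section Multiplicative.
Variables (op : M -> M -> M) (a : E).
Hypotheses (op_bilinear : bilinear_op op) (opA : associative op)
  (opC : commutative op) (op1 : left_id (delta a) op)
  (op_continuous : weakly_continuous_op op)
  (op_probability : preserves_probability op).
Variable theta : E -> R[i].
Hypotheses (theta_bmeas : bmeasE theta) (theta_neq0 : exists x, theta x != 0)
  (theta_mult : forall x y, Int (op (delta x) (delta y)) theta = theta x * theta y).

Lemma theta_unit : theta a = 1.
Proof.
have [x x0] := theta_neq0; have := theta_mult a x.
by rewrite op1 Int_delta// -[LHS]mul1r => /(mulIf x0).
Qed.

(** With [S] the supremum, [|theta x| |theta y| <= S] for all [y] gives
    [S |theta x| <= S]. *)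
Lemma sup_norm_theta : sup_norm theta = 1.
Proof.
have [_ _ [N thN]] := theta_bmeas.
have ub : has_ubound (range (fun x => normc (theta x))).
  by exists N => _ [x _ <-].
have le_sup x : normc (theta x) <= sup_norm theta by apply: sup_ubound => //; exists x.
have s1 : 1 <= sup_norm theta by rewrite -(Normc.normc1 R) -theta_unit.
have prod x y : normc (theta x) * normc (theta y) <= sup_norm theta.
  rewrite -Normc.normcM -theta_mult.
  have [rho ->] := delta_op_probability op_probability x (@dirac _ (borel E) y R).
  exact: Int_probability.
apply/eqP; rewrite eq_le s1 andbT; apply: sup_le_ub.
  by exists (normc (theta a)), a.
move=> _ [x _ <-]; have [->|x0] := eqVneq (normc (theta x)) 0; first by [].
have x1 : 0 < normc (theta x) by rewrite lt_def x0 normc_ge0.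
rewrite -(ler_pM2r (lt_le_trans ltr01 s1)) mul1r mulrC -ler_pdivlMr//.
apply: sup_le_ub; first by exists (normc (theta a)), a.
by move=> _ [y _ <-]; rewrite ler_pdivlMr// mulrC.
Qed.

Lemma theta_le1 x : normc (theta x) <= 1.
Proof.
have [_ _ [N thN]] := theta_bmeas.
by rewrite -sup_norm_theta; apply: sup_ubound; [exists N => _ [y _ <-]|exists x].
Qed.

(** The function [theta] is an eigenfunction of every translation, in particular
    of the semigroup. *)
Lemma translate_theta (P : probability (borel E) R) x :
  translate op (of_finite_measure P) theta x =
  Int (of_finite_measure P) theta * theta x.
Proof.
rewrite /translate opC.
have [_ ->] := translate_bmeas op_bilinear op_continuous op_probability
  (@dirac _ (borel E) x R) theta_bmeas.
rewrite mulrC -IntZ//; congr (integral_complex_measure _ _); apply/funext => y.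
by rewrite mulrC -theta_mult.
Qed.

Lemma Int_op_theta (P Q : probability (borel E) R) :
  Int (op (of_finite_measure P) (of_finite_measure Q)) theta =
  Int (of_finite_measure P) theta * Int (of_finite_measure Q) theta.
Proof.
have [_ ->] := translate_bmeas op_bilinear op_continuous op_probability Q theta_bmeas.
by rewrite (funext (translate_theta Q)) IntZ// mulrC.
Qed.

(** The rest of the space contributes at most [1 - P Z], less than [P Z], because
    [theta] is bounded by 1. *)
Lemma Int_theta_neq0 (P : probability (borel E) R) (Z : set (borel E)) :
  measurable Z -> (forall x, Z x -> theta x = 1) ->
  1 / 2 < fine ((P : {measure set (borel E) -> \bar R}) Z) ->
  Int (of_finite_measure P) theta != 0.
Proof.
move=> mZ Z1 half; apply/negP => /eqP I0.
have bZ := bmeas_indic R mZ.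
have bd : bmeasE (fun x => theta x - cindic Z x) := bmeasB theta_bmeas bZ.
pose v (x : E) : R := 1 - \1_Z x.
have mv : measurable_fun setT (v : borel E -> R).
  by apply: measurable_funB => //; exact: measurable_indic.
have v0 x : 0 <= v x <= 1.
  by rewrite /v indicE; case: (x \in Z); rewrite /= ?subrr ?subr0 ?lexx ?ler01.
have v1 x : `|v x| <= 1 by rewrite ger0_norm; case/andP: (v0 x).
have := normc_Int P bd mv v1; rewrite IntB// I0 sub0r normc_opp => H.
have {}H : normc (Int (of_finite_measure P) (cindic Z)) <= \int[P]_(x in setT) v x.
  apply: H => x; rewrite /v /cindic indicE; have [xZ|xZ] := boolP (x \in Z).
    by rewrite Z1 ?subrr ?Normc.normc0//; exact: set_mem.
  by rewrite subr0 subr0; exact: theta_le1.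
have ReZ : Re (Int (of_finite_measure P) (cindic Z)) =
  fine ((P : {measure set (borel E) -> \bar R}) Z) by rewrite -fine_measureE.
have vE : \int[P]_(x in setT) v x = 1 - fine ((P : {measure set (borel E) -> \bar R}) Z).
  rewrite -(Re_Int_real P mv v1).
  have -> : (fun x => (v x)%:C) = (fun x => cst 1 x - cindic Z x).
    by apply/funext => x; rewrite /v rmorphB.
  rewrite IntB//; last exact: bmeas_cst.
  by rewrite Int_cst -ReZ; move: (Int _ _) => z; rewrite Re_add Re_opp.
have := le_trans (ler_norm _) (le_trans (Re_le_normc _) H).
by rewrite ReZ vE; lra.
Qed.

End Multiplicative.
End Character.

Section Concentration.
Context (R : realType) (E : pointedMetricType R).
Local Notation M := (complex_measure (borel E) R).
Local Notation Int := (@integral_complex_measure _ (borel E) R).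
Implicit Types (f g h : E -> R[i]) (x y : E) (t s : R).
Variables (gamma : R -> probability (borel E) R) (a : E).
Local Notation mu t := (of_finite_measure (gamma t)).
Hypothesis gamma_weak : forall f, Cb f -> Int (mu t) f @[t --> 0^'+] --> f a.
Hypothesis gamma_setwise : forall h, Bb h -> cvg (Int (mu t) h @[t --> 0^'+]).

(** The atom at [a] is written as the set where the distance to [a] is
    nonpositive. *)
Lemma mass_at_unit : exists2 t, 0 < t &
  1 / 2 < fine ((gamma t : {measure set (borel E) -> \bar R}) [set x | mdist a x <= 0]).
Proof.
have cD := @mdist_continuous R E a.
apply: (concentration_charges_zero_set (continuous_borel cD)).
- move=> r r0; pose A := [set x : E | r <= mdist a x].
  have mA : measurable (A : set (borel E)).
    by rewrite -[X in measurable X]setTI; apply: measurable_fun_ler => //; exact: continuous_borel.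
  pose u x := Num.min 1 (r^-1 * mdist a x).
  have cu : continuous u.
    move=> x; apply: (@continuous_min _ _ (cst 1) (fun x => r^-1 * mdist a x)).
      exact: cvg_cst.
    by apply: cvgM; [exact: cvg_cst|exact: cD].
  have u0 x : 0 <= u x by rewrite le_min ler01 mulr_ge0 ?mdist_ge0// invr_ge0 ltW.
  have u1 x : `|u x| <= 1 by rewrite ger0_norm// ge_min lexx.
  have := gamma_weak (Cb_real cu u1); rewrite /u mdistxx mulr0 min_r// => /cvg_complexP[+ _].
  rewrite -/u => lim; apply: (squeeze_cvgr _ _ lim); last exact: cvg_cst.
  near=> t; rewrite fine_ge0//= (Re_Int_real _ (continuous_borel cu) u1).
  rewrite fine_measureE// (Re_Int_real (gamma t) (u := \1_A) (N := 1)) //.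
  + apply: le_Rintegral => //.
    * apply: (bounded_integrable (gamma t) (M := 1)) => [|x]; first exact: measurable_indic.
      by rewrite indicE; case: (_ \in _); rewrite ?normr1 ?normr0.
    * exact: (bounded_integrable (gamma t) (continuous_borel cu) u1).
    move=> x _; rewrite indicE; have [xA|xA] := boolP (x \in A) => //.
    have {}xA : r <= mdist a x by exact: (set_mem xA).
    by rewrite /u le_min lexx/= ler_pdivlMl// mulr1.
  + by move=> x; rewrite indicE; case: (_ \in _); rewrite ?normr1 ?normr0.
move=> A mA; have /cvg_ex[l /= /cvg_complexP[lP _]] := gamma_setwise (Bb_cindic mA).
apply/cvg_ex; exists (Re l); move: lP; apply: cvg_trans; apply: near_eq_cvg.
by near=> t; rewrite fine_measureE.
Unshelve. all: by end_near. Qed.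

End Concentration.

Theorem proposition3p1 (R : realType) (E : pointedMetricType R)
  (E_locally_compact : locally_compact [set: E])
  (E_separable : separable_space E)
  (T : R -> (E -> R[i]) -> E -> R[i])
  (p : R -> E -> subprobability (borel E) R)
  (T_feller : feller_semigroup T)
  (T_kernel : transition_kernel T p)
  (T_strong_feller : strong_feller p)
  (op : complex_measure (borel E) R -> complex_measure (borel E) R ->
        complex_measure (borel E) R)
  (a : E)
  (op_algebra : commutative_banach_algebra op (delta a))
  (op_continuous : weakly_continuous_op op)
  (op_probability : preserves_probability op)
  (op_semigroup : generated_by_convolution_semigroup op p)
  (theta : E -> R[i])
  (theta_Bb : Bb theta)
  (theta_neq0 : exists x, theta x != 0)
  (theta_mult : forall x y,
    integral_complex_measure (op (delta x) (delta y)) theta =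
    theta x * theta y) :
  [/\ theta a = 1, sup_norm theta = 1 &
      exists2 lambda : R[i], 0 <= complex.Re lambda &
        forall eta : R, 0 < eta ->
          Cb_generator p eta theta (fun x => - lambda * theta x)].
Proof.
have [op_bilinear opA opC op1 _] := op_algebra.
have [gamma [gammaD pE]] := op_semigroup.
have theta_bmeas := Bb_bmeas theta_Bb.
have theta_a := theta_unit op1 theta_bmeas theta_neq0 theta_mult.
have theta_sup := sup_norm_theta op1 op_probability theta_bmeas theta_neq0 theta_mult.
have theta1 := theta_le1 op1 op_probability theta_bmeas theta_neq0 theta_mult.
split=> //.
have Tc := translate_theta op_bilinear opC op_continuous op_probability theta_bmeas theta_mult.
have weak := gamma_cvg E_locally_compact T_feller T_kernel opC op1 pE.
have [t0 t00 mass] := mass_at_unit weak (gamma_Bb_cvg E_locally_compact T_feller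
  T_kernel T_strong_feller op_bilinear opA opC op1 op_continuous op_probability gammaD pE).
pose c t := integral_complex_measure (of_finite_measure (gamma t)) theta.
have c0 : c t0 != 0.
  apply: (Int_theta_neq0 op1 op_probability theta_bmeas theta_neq0 theta_mult _ _ mass).
    rewrite -[X in measurable X]setTI; apply: measurable_fun_ler => //.
    exact: (continuous_borel (@mdist_continuous R E a)).
  move=> x /= xa; have <- : a = x.
    by apply: mdist_positivity; apply/eqP; rewrite eq_le xa mdist_ge0.
  exact: theta_a.
(* [theta = T_t0 theta / c t0] is continuous by the strong Feller property *)
have theta_Cb : Cb theta.
  have := semigroup_Cb T_strong_feller opC pE t00 theta_Bb.
  move=> /(fun h => Cb_lin (c t0)^-1 h (Cb_cst E 0)); congr Cb; apply/funext => x.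
  by rewrite Tc addr0 mulKf.
have c_le1 t : 0 <= t -> Normc.normc (c t) <= 1 by move=> _; exact: Int_probability.
have cD s t : 0 <= s -> 0 <= t -> c (s + t) = c s * c t.
  move=> s0 t0'; rewrite /c gammaD//.
  exact: (Int_op_theta op_bilinear opC op_continuous op_probability theta_bmeas theta_mult).
have c_cvg : c t @[t --> 0^'+] --> (1 : R[i]) by rewrite -theta_a; exact: weak.
have [lambda lambda0 lambdaE] := laplace_multiplicative c_le1 cD c_cvg.
exists lambda => // eta eta0.
exists (fun x => (eta%:C + lambda) * theta x); split.
- have := Cb_lin (eta%:C + lambda) theta_Cb (Cb_cst E 0); congr Cb.
  by apply/funext => x; rewrite addr0.
- apply/funext => x; rewrite /resolvent.
  have integrandE t : t \in `[0, +oo[%classic -> (expR (- (eta * t)))%:C *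
      kernel_op p t (fun x => (eta%:C + lambda) * theta x) x =
      (expR (- (eta * t)))%:C * ((eta%:C + lambda) * theta x * c t).
    rewrite inE/= in_itv/= andbT => t0'; congr (_ * _).
    rewrite (kernel_opE opC pE)//; last exact: bmeasZ.
    by rewrite /translate IntZ// -/(translate _ _ _ _) Tc -mulrA (mulrC (theta x)).
  transitivity (complex_integral lebesgue_measure `[0, +oo[
      (fun t => (expR (- (eta * t)))%:C * ((eta%:C + lambda) * theta x * c t))).
    by rewrite laplace_scale// mulrAC lambdaE// mul1r.
  by rewrite /complex_integral; congr (_ +i* _); apply: eq_Rintegral => t tI; rewrite integrandE.
- by move=> x; ring.
Qed.
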